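(* Let $G$ be a finite connected graph with at least two vertices and edge set $E$, and fix an acyclic cycle signature $\sigma$ and an acyclic cocycle signature $\sigma^*$. For every $\sigma$-compatible (discrete) orientation $\overrightarrow{O}$, there is a unique pair $(T,\overrightarrow{C^*})$ with $T$ a spanning tree and $\overrightarrow{C^*}\in\operatorname{im}_\mathbb{Z}(D^T)$ such that $\overrightarrow{O}\in(\mathrm{hoc}_{\sigma,\sigma^*}(T)-\overrightarrow{C^*})\cap[0,1]^E$, and this set is a standard half-open cell; let $\varphi_{\sigma,\sigma^*}(\overrightarrow{O})$ be its generating set. Then $\varphi_{\sigma,\sigma^*}$ is a bijection from the set of $\sigma$-compatible orientations of $G$ to the set of spanning forests of $G$.
   Context: $G$ is a finite connected graph (loops and multiple edges allowed). Fix a reference orientation; orientations are identified with $\{0,1\}^E$ and continuous orientations with $[0,1]^E$ (coordinate $1$: oriented as in the reference orientation; $0$: oppositely; strictly between: ''bi-oriented''). Directed cycles (cycles with a cyclic direction) and directed cocycles (inclusion-minimal cuts with all edges directed from one side to the other) are identified with $\{0,\pm1\}$-vectors ($+1$ where directed as the reference, $-1$ where opposite). $D$ is the vertex–edge incidence matrix of the reference orientation (entry $1$ if the vertex is the head of a non-loop arc, $-1$ if tail, $0$ otherwise) with its last row removed; $\operatorname{im}_\mathbb{Z}(D^T)=\operatorname{im}(D^T)\cap\mathbb{Z}^E$. A cycle signature $\sigma$ chooses a direction $\sigma(C)$ of each cycle $C$; it is acyclic if $\sum_C a_C\sigma(C)=0$ with all $a_C\ge0$ forces all $a_C=0$. A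 discrete orientation is $\sigma$-compatible if every directed cycle contained in it is of the form $\sigma(C)$. Acyclic cocycle signatures $\sigma^*$ are defined analogously with cocycles. For a spanning tree $T$: $C(T,e)$ ($e\notin T$) is the unique cycle in $T\cup\{e\}$ and $C^*(T,e)$ ($e\in T$) is the unique cocycle in $(E\setminus T)\cup\{e\}$. $\mathrm{hoc}_{\sigma,\sigma^*}(T)\subseteq[0,1]^E$ is the set of continuous orientations in which each $e\notin T$ is oriented as in $\sigma(C(T,e))$ and each $e\in T$ is either oriented as in $\sigma^*(C^*(T,e))$ or bi-oriented. A standard half-open cell in $\mathbb{R}^E$ is a set $\prod_{e\in E}I_e$ with each $I_e$ equal to $\{a_e\}$, $(a_e-1,a_e]$ or $[a_e,a_e+1)$ for integers $a_e$; its generating set is $\{e: I_e\text{ is not a point}\}$. A spanning forest is a subset of $E$ containing no cycle. *)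

(* Defs.v *)
From HB Require Import structures.
From mathcomp Require Import all_boot all_order all_algebra.
From mathcomp Require Import boolp classical_sets functions reals.

Set Implicit Arguments.
Unset Strict Implicit.
Unset Printing Implicit Defensive.

Import Order.TTheory GRing.Theory Num.Theory.

Local Open Scope ring_scope.

(* Finite graph with loops and multiple edges allowed; [etail] and [ehead] give
   the reference orientation. *)
Record multigraph := Multigraph {
  vertex : finType;
  edge : finType;
  etail : edge -> vertex;
  ehead : edge -> vertex }.

Arguments etail {_} _.
Arguments ehead {_} _.

Section Graph.
Variable G : multigraph.
Local Notation V := (vertex G).
Local Notation E := (edge G).

Definition adjacent (A : {set E}) : rel V :=
  fun u v => [exists e in A, ((etail e == u) && (ehead e == v))
                          || ((etail e == v) && (ehead e == u))].

Definition connected_by (A : {set E}) : Prop :=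
  forall u v : V, connect (adjacent A) u v.

Definition connected_graph : Prop := connected_by [set: E].

Definition support_of (w : {ffun E -> int}) : {set E} := [set e | w e != 0].

(* A dart [(e, b)] is the edge [e] traversed as in the reference orientation
   when [b = true] and oppositely when [b = false]; a loop has two darts. *)
Definition dart_src (d : E * bool) : V := if d.2 then etail d.1 else ehead d.1.
Definition dart_dst (d : E * bool) : V := if d.2 then ehead d.1 else etail d.1.

(* The condition on edges only excludes going back and forth along a single
   edge. *)
Definition closed_simple_walk (s : seq (E * bool)) : bool :=
  [&& s != [::],
      path.cycle (fun d d' => dart_dst d == dart_src d') s,
      uniq (map dart_src s)
    & uniq (map fst s)].

Definition walk_vec (s : seq (E * bool)) : {ffun E -> int} :=
  [ffun e => if (e, true) \in s then 1 else if (e, false) \in s then -1 else 0].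

Definition directed_cycle (w : {ffun E -> int}) : Prop :=
  exists2 s, closed_simple_walk s & w = walk_vec s.

Definition is_cycle (C : {set E}) : Prop :=
  exists2 w, directed_cycle w & support_of w = C.

Definition cut (U : {set V}) : {set E} :=
  [set e | (etail e \in U) != (ehead e \in U)].

Definition is_cut (C : {set E}) : Prop :=
  exists U : {set V}, [/\ U != finset.set0, U != [set: V] & C = cut U].

Definition is_cocycle (C : {set E}) : Prop :=
  is_cut C /\ forall C', is_cut C' -> C' \subset C -> C' = C.

(* All edges of [cut U] directed from the complement of [U] into [U]. *)
Definition cut_vec (U : {set V}) : {ffun E -> int} :=
  [ffun e => (ehead e \in U)%:R - (etail e \in U)%:R].

Definition directed_cocycle (w : {ffun E -> int}) : Prop :=
  is_cocycle (support_of w) /\ exists U, w = cut_vec U.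

Definition spanning_forest (F : {set E}) : Prop :=
  forall C, is_cycle C -> ~~ (C \subset F).

Definition spanning_tree (T : {set E}) : Prop :=
  spanning_forest T /\ connected_by T.

Definition fund_cycle (T : {set E}) (e : E) : {set E} :=
  xget finset.set0 [set C : {set E} | is_cycle C /\ C \subset e |: T]%classic.

Definition fund_cocycle (T : {set E}) (e : E) : {set E} :=
  xget finset.set0 [set C : {set E} | is_cocycle C /\ C \subset e |: ~: T]%classic.

(* A signature is a function on edge sets of which only the values on cycles
   (resp. cocycles) matter. *)
Definition cycle_signature (sigma : {set E} -> {ffun E -> int}) : Prop :=
  forall C, is_cycle C -> directed_cycle (sigma C) /\ support_of (sigma C) = C.

Definition cocycle_signature (sigma : {set E} -> {ffun E -> int}) : Prop :=
  forall C, is_cocycle C ->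
    directed_cocycle (sigma C) /\ support_of (sigma C) = C.

Definition contained_in (w : {ffun E -> int}) (O : {ffun E -> bool}) : Prop :=
  forall e, (w e = 1 -> O e = true) /\ (w e = -1 -> O e = false).

Definition compatible (sigma : {set E} -> {ffun E -> int})
    (O : {ffun E -> bool}) : Prop :=
  forall w, directed_cycle w -> contained_in w O ->
    exists2 C, is_cycle C & w = sigma C.

Section Real.
Variable R : realType.
Implicit Types (x : {ffun E -> R}) (c w : {ffun E -> int}) (O : {ffun E -> bool}).

Definition acyclic_on (P : {set E} -> Prop)
    (sigma : {set E} -> {ffun E -> int}) : Prop :=
  forall a : {set E} -> R,
    (forall C, P C -> 0 <= a C) ->
    (forall e, \sum_(C : {set E} | `[< P C >]) a C * (sigma C e)%:~R = 0) ->
    forall C, P C -> a C = 0.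

Definition acyclic_cycle_signature (sigma : {set E} -> {ffun E -> int}) : Prop :=
  cycle_signature sigma /\ acyclic_on is_cycle sigma.

Definition acyclic_cocycle_signature (sigma : {set E} -> {ffun E -> int}) : Prop :=
  cocycle_signature sigma /\ acyclic_on is_cocycle sigma.

(* Vertices and edges are numbered by [enum_val]; restricting the row index to
   ['I_#|V|.-1] removes the last row. The two terms cancel on loops. *)
Definition incidence : 'M[R]_(#|V|.-1, #|E|) :=
  \matrix_(i, j)
    ((ehead (enum_val j) == enum_val (widen_ord (leq_pred #|V|) i))%:R
     - (etail (enum_val j) == enum_val (widen_ord (leq_pred #|V|) i))%:R).

Definition im_Z c : Prop :=
  exists y : 'cV[R]_(#|V|.-1),
    \col_(j < #|E|) (c (enum_val j))%:~R = incidence^T *m y.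

Definition of_int c : {ffun E -> R} := [ffun e => (c e)%:~R].
Definition of_bool O : {ffun E -> R} := [ffun e => (O e)%:R].

Definition cube : set {ffun E -> R} := [set x | forall e, 0 <= x e <= 1]%classic.

Definition oriented_as x w (e : E) : Prop :=
  (w e = 1 /\ x e = 1) \/ (w e = -1 /\ x e = 0).

Definition bioriented x (e : E) : Prop := 0 < x e < 1.

Definition hoc (sigma sigma' : {set E} -> {ffun E -> int}) (T : {set E}) :
    set {ffun E -> R} :=
  [set x | [/\ cube x,
     forall e, e \notin T -> oriented_as x (sigma (fund_cycle T e)) e
   & forall e, e \in T ->
       oriented_as x (sigma' (fund_cocycle T e)) e \/ bioriented x e]]%classic.

(* [half_open_cell J A]: [A] is a standard half-open cell with generating
   set [J]. *)
Definition half_open_cell (J : {set E}) (A : set {ffun E -> R}) : Prop :=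
  exists I : E -> interval R,
    [/\ forall e, e \in J -> exists a : int,
          I e = `]a%:~R - 1, a%:~R] \/ I e = `[a%:~R, a%:~R + 1[,
        forall e, e \notin J -> exists a : int, I e = `[a%:~R, a%:~R]
      & A = [set x | forall e, x e \in I e]%classic].

Definition shifted_cell (sigma sigma' : {set E} -> {ffun E -> int})
    (T : {set E}) c : set {ffun E -> R} :=
  ([set x - of_int c | x in hoc sigma sigma' T] `&` cube)%classic.

Definition assigned (sigma sigma' : {set E} -> {ffun E -> int}) O
    (p : {set E} * {ffun E -> int}) : Prop :=
  [/\ spanning_tree p.1, im_Z p.2
    & shifted_cell sigma sigma' p.1 p.2 (of_bool O)].

Definition phi (sigma sigma' : {set E} -> {ffun E -> int}) O : {set E} :=
  xget finset.set0 [set J : {set E} | exists2 p, assigned sigma sigma' O p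
    & half_open_cell J (shifted_cell sigma sigma' p.1 p.2)]%classic.

End Real.
End Graph.

Arguments cube {G} R _.
Arguments hoc {G} R sigma sigma' T _.
Arguments shifted_cell {G} R sigma sigma' T c _.

(* Main.v *)
(* An orientation O has O + c in the half-open cell of T exactly when O + c is
   the orientation given by the fundamental cycles (off T) and the fundamental
   cocycles (on T), and the generating set is then the set of edges of T where
   c vanishes. So everything is combinatorics of integral flows and cut
   vectors, which are orthogonal to each other and decompose conformally into
   directed cycles and cocycles.

   The core is the bijection of Backman, Baker and Yuen for minors: an
   orientation of A / F whose directed cycles and cocycles all agree with the
   signatures comes from exactly one tree T with F <= T <= A. Uniqueness is
   Minty's painting lemma applied to two trees; existence is by deletion and
   contraction of an edge, at least one of which preserves the hypotheses
   because flows and cut vectors are orthogonal.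

   For F = set0, A = E, apply it to a maximal cocycle reversal of O, in the
   order given by the cone of the cocycle signature. For a general forest F, the
   reversal c that produces F is the maximum of the cut vectors with entries in
   {-1, 0, 1} that vanish on F, and T is the tree that the core result assigns
   to the orientation of supp c given by c, with A = F U supp c. *)
Require Import Defs.
From mathcomp Require Import all_boot all_order all_algebra.
From mathcomp Require Import boolp classical_sets functions reals.
From mathcomp Require Import zify lra fintype finset.

Set Implicit Arguments.
Unset Strict Implicit.
Unset Printing Implicit Defensive.

Import Order.TTheory GRing.Theory Num.Theory.

Local Open Scope ring_scope.

(** * Integer vectors, the cone of a signature, conformal decomposition *)

Lemma absz_unitB (w k : int) :
  [\/ w = 0, w = 1 | w = -1] -> (w != 0 -> 0 < w * k) ->
  `|k|%N = (`|(k - w)%R| + `|w|)%N.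
Proof. by case=> ->; rewrite ?mul1r ?mulN1r; lia. Qed.

Lemma unitB_gt0 (w' w k : int) :
    [\/ w' = 0, w' = 1 | w' = -1] -> [\/ w = 0, w = 1 | w = -1] ->
  (w != 0 -> 0 < w * k) -> 0 < w' * (k - w) -> 0 < w' * k.
Proof. by case=> ->; case=> ->; rewrite ?mul1r ?mulN1r; lia. Qed.

Section IntVectors.
Variable E : finType.
Local Notation vec := {ffun E -> int}.
Implicit Types (k w : vec) (P : {set E} -> Prop) (sigma : {set E} -> vec).

Definition cone P sigma k : Prop :=
  exists a : {set E} -> nat, k = \sum_(C : {set E} | `[< P C >]) sigma C *+ a C.

(** The form in which acyclicity is used: the cone contains no line, hence defines a partial order
    on vectors. *)
Definition pointed P sigma : Prop :=
  forall k, cone P sigma k -> cone P sigma (- k) -> k = 0.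

Lemma cone0 P sigma : cone P sigma 0.
Proof.
by exists (fun=> 0%N); rewrite big1 // => C _; rewrite mulr0n.
Qed.

Lemma coneD P sigma k k' :
  cone P sigma k -> cone P sigma k' -> cone P sigma (k + k').
Proof.
move=> [a ->] [b ->]; exists (fun C => a C + b C)%N.
by rewrite -big_split; apply: eq_bigr => C _; rewrite mulrnDr.
Qed.

Lemma cone_gen P sigma C : P C -> cone P sigma (sigma C).
Proof.
move=> PC; exists (fun D => (D == C) : nat).
rewrite (bigD1 C) /=; last exact/asboolP.
rewrite eqxx mulr1n big1 ?addr0 // => D /andP[_ /negPf->].
by rewrite mulr0n.
Qed.

Lemma coneMn P sigma k n : cone P sigma k -> cone P sigma (k *+ n).
Proof.
move=> Kk; elim: n => [|n IHn]; first by rewrite mulr0n; exact: cone0.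
by rewrite mulrS; exact: coneD.
Qed.

Lemma pointed_gen P sigma C :
  pointed P sigma -> P C -> cone P sigma (- sigma C) -> sigma C = 0.
Proof. by move=> Ksig PC; apply: Ksig; exact: cone_gen. Qed.

(** Instantiated by [flow] and by [cutv], so that cycles and cocycles share the cone lemmas. *)
Definition additive_pred (Q : vec -> Prop) : Prop :=
  Q 0 /\ forall k k', Q k -> Q k' -> Q (k - k').

Lemma additive_predN Q k : additive_pred Q -> Q k -> Q (- k).
Proof. by move=> [Q0 QB] Qk; rewrite -sub0r; exact: QB. Qed.

Lemma additive_predD Q k k' : additive_pred Q -> Q k -> Q k' -> Q (k + k').
Proof.
move=> aQ Qk Qk'; rewrite -[k']opprK; apply: aQ.2 => //.
exact: additive_predN.
Qed.

Lemma additive_predMn Q k n : additive_pred Q -> Q k -> Q (k *+ n).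
Proof.
move=> aQ Qk; elim: n => [|n IHn]; first by rewrite mulr0n; exact: aQ.1.
by rewrite mulrS; exact: additive_predD.
Qed.

(* [f e] is the fundamental vector of [e] with respect to a basis whose
   complement is [S]; [k] is then [\sum_(e in S) k e * f e e *: f e]. *)
Lemma cone_expand P sigma (Q : vec -> Prop) (S : {set E}) (f : E -> vec) k :
    additive_pred Q ->
    (forall k', Q k' -> (forall e, e \in S -> k' e = 0) -> k' = 0) ->
    (forall e, e \in S -> [/\ Q (f e), cone P sigma (f e),
       f e e = 1 \/ f e e = -1
       & forall e', e' \in S -> e' != e -> f e e' = 0]) ->
    Q k -> (forall e, e \in S -> 0 <= k e * f e e) ->
  cone P sigma k.
Proof.
move=> aQ Q0 fP Qk kP.
pose x := \sum_(e in S) f e *+ `|k e|%N.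
suff -> : k = x.
  apply: (big_ind (cone P sigma)) => [|u v|e /fP[]].
  - exact: cone0.
  - exact: coneD.
  - by move=> _ Kf _ _; exact: coneMn.
apply/eqP; rewrite -subr_eq0; apply/eqP/Q0.
  apply: aQ.2 => //; apply: (big_ind Q) => [|u v|e /fP[Qf _ _ _]].
  - exact: aQ.1.
  - exact: additive_predD.
  - exact: additive_predMn.
move=> e eS; have [_ _ fe _] := fP e eS.
rewrite !ffunE /x sum_ffunE (bigD1 e) //= big1 => [|e' /andP[e'S ne]].
  rewrite addr0 ffunMnE -mulr_natr natz; have := kP e eS.
  by case: fe => ->;
    rewrite ?mulr1 ?mulrN1 ?mul1r ?mulN1r ?oppr_ge0 ?opprK => ke; lia.
have [_ _ _ /(_ e eS) fe0] := fP e' e'S.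
by rewrite ffunMnE fe0 ?mul0rn // eq_sym.
Qed.

Definition conformal w k : Prop := forall e, w e != 0 -> 0 < w e * k e.

Definition unit_valued w : Prop := forall e, [\/ w e = 0, w e = 1 | w e = -1].

(** Induction on the sum of absolute values: subtracting a [w] conformal to [k] lowers it, and
    whatever in [D] is conformal to [k - w] is conformal to [k], so the last hypothesis survives. *)
Lemma cone_conformal P sigma (Q D : vec -> Prop) k :
    additive_pred Q -> (forall w, D w -> [/\ Q w, unit_valued w & w != 0]) ->
    (forall k, Q k -> k != 0 -> exists2 w, D w & conformal w k) ->
    Q k -> (forall w, D w -> conformal w k -> cone P sigma w) ->
  cone P sigma k.
Proof.
move=> aQ DP exD.
have [n] := ubnP (\sum_e `|k e|%N); elim: n k => // n IHn k kn Qk Hk.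
have [->|k0] := eqVneq k 0; first exact: cone0.
have [w Dw wk] := exD k Qk k0; have [Qw wu w0] := DP w Dw.
rewrite -(subrK w k); apply: coneD; last exact: Hk.
have dec e : `|k e|%N = (`|(k - w)%R e| + `|w e|)%N.
  by rewrite !ffunE; exact: absz_unitB (wu e) (wk e).
have wpos : (0 < \sum_e `|w e|)%N.
  rewrite lt0n sum_nat_eq0; apply: contra w0 => /forallP w0.
  apply/eqP/ffunP => e; rewrite ffunE.
  by move: (w0 e); rewrite absz_eq0 => /eqP.
apply: IHn.
- rewrite ltnS in kn; apply: leq_trans kn.
  under [leqRHS]eq_bigr do rewrite dec.
  by rewrite big_split -[ltnLHS]addn0 ltn_add2l.
- exact: aQ.2.
- move=> w' Dw' w'k; apply: Hk => // e w'e.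
  have [_ w'u _] := DP w' Dw'; have := w'k e w'e; rewrite !ffunE.
  exact: unitB_gt0 (w'u e) (wu e) (wk e).
Qed.

(** Pointedness makes the cone order antisymmetric, so an index with the smallest up-set is maximal.
    The index type supplies finiteness. *)
Lemma exists_maximal (P : {set E} -> Prop) sigma (I : finType) (f : I -> vec)
    (Q : I -> Prop) i0 :
    pointed P sigma -> Q i0 ->
  exists2 i, Q i & forall j, Q j -> cone P sigma (f j - f i) -> f j = f i.
Proof.
move=> Ksig Qi0; pose up i := [set j | `[< cone P sigma (f j - f i) >]].
have [i Qi mini] := arg_minnP (fun i => #|up i|) (P := fun i => `[< Q i >])
  (introT (asboolP _) Qi0).
exists i; first exact/asboolP.
move=> j Qj ij; apply/eqP; apply: contraT => nfij.
have : (#|up j| < #|up i|)%N.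
  apply: proper_card; apply/properP; split.
    apply/subsetP => l; rewrite !inE => /asboolP jl; apply/asboolP.
    by have := coneD jl ij; rewrite addrA subrK.
  exists i; rewrite !inE; apply/asboolP; first by rewrite subrr; exact: cone0.
  move=> ji; move/eqP: nfij; apply; apply: subr0_eq; apply: Ksig => //.
  by rewrite opprB.
by rewrite ltnNge mini //; exact/asboolP.
Qed.

End IntVectors.

(** * Flows, cut vectors and directed cycles *)

Section Graph.
Variable G : multigraph.
Local Notation V := (vertex G).
Local Notation E := (edge G).
Local Notation vec := {ffun E -> int}.
Implicit Types (k w : vec) (A F T : {set E}) (U : {set V}).
Implicit Types (h : V -> int) (s : seq (E * bool)).

Definition grad h : vec := [ffun e => h (ehead e) - h (etail e)].

(** Conservation at every vertex, tested against all potentials at once. *)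
Definition flow k : Prop := forall h, \sum_e k e * grad h e = 0.

Definition cutv (c : vec) : Prop := exists h, c = grad h.

Definition sgnb (b : bool) : int := if b then 1 else -1.

Lemma sgnb_sq b : sgnb b * sgnb b = 1.
Proof. by case: b. Qed.

Lemma sgnbN b : sgnb (~~ b) = - sgnb b.
Proof. by case: b; rewrite // opprK. Qed.

Lemma flow_additive : additive_pred flow.
Proof.
split=> [h|k k' fk fk' h]; first by rewrite big1 // => e _; rewrite ffunE mul0r.
transitivity (\sum_e k e * grad h e - \sum_e k' e * grad h e).
  by rewrite -sumrB; apply: eq_bigr => e _; rewrite !ffunE mulrBl.
by rewrite fk fk' subrr.
Qed.

Lemma cutv_additive : additive_pred cutv.
Proof.
split; first by exists (fun=> 0); apply/ffunP => e; rewrite !ffunE.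
move=> _ _ [h ->] [h' ->]; exists (fun v => h v - h' v).
by apply/ffunP => e; rewrite !ffunE; lia.
Qed.

Lemma cut_vecE U : cut_vec U = grad (fun v => (v \in U)%:R).
Proof. by apply/ffunP => e; rewrite !ffunE. Qed.

Lemma cutv_cut_vec U : cutv (cut_vec U).
Proof. by exists (fun v => (v \in U)%:R); exact: cut_vecE. Qed.

Lemma flow_orth k d : flow k -> cutv d -> \sum_e k e * d e = 0.
Proof. by move=> fk [h ->]; exact: fk. Qed.

Lemma grad_const A h : connected_by A ->
  (forall e, e \in A -> grad h e = 0) -> forall u v, h u = h v.
Proof.
move=> cA h0 u v; have /connectP[p pp ->] := cA u v.
elim: p u pp => //= x p IHp u /andP[/existsP[e /andP[eA ux]] /IHp<-].
have := h0 e eA; rewrite ffunE.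
by case/orP: ux => /andP[/eqP-> /eqP->]; lia.
Qed.

Lemma cutv_eq0 A d : connected_by A -> cutv d ->
  (forall e, e \in A -> d e = 0) -> d = 0.
Proof.
move=> cA [h ->] d0; apply/ffunP => e; rewrite !ffunE.
by rewrite (grad_const cA d0 (ehead e) (etail e)) subrr.
Qed.

Lemma disconnected_cut A : ~ connected_by A ->
  exists U, [/\ forall e, e \in A -> cut_vec U e = 0
              & exists u v, u \in U /\ v \notin U].
Proof.
move=> ncA; have [u [v uv]] : exists u v, ~~ connect (adjacent A) u v.
  apply: contrapT => H; apply: ncA => u v; apply: contraT => uv.
  by case: H; exists u, v.
exists [set x | connect (adjacent A) u x]; split; last first.
  by exists u, v; rewrite !inE connect0.
have asym e x y : e \in A -> (etail e, ehead e) \in [:: (x, y); (y, x)] ->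
    connect (adjacent A) u x -> connect (adjacent A) u y.
  move=> eA exy /connect_trans; apply; apply/connect1/existsP; exists e.
  by rewrite eA /=; move: exy; rewrite !inE !xpair_eqE.
move=> e eA; rewrite ffunE !inE.
suff -> : connect (adjacent A) u (ehead e) = connect (adjacent A) u (etail e).
  by rewrite subrr.
by apply/idP/idP; apply: (asym e) => //; rewrite !inE eqxx ?orbT.
Qed.

Lemma grad_dart h (d : E * bool) :
  sgnb d.2 * grad h d.1 = h (dart_dst d) - h (dart_src d).
Proof.
by case: d => e []; rewrite ffunE /dart_dst /dart_src /= ?mul1r ?mulN1r ?opprB.
Qed.

Definition chain (d d' : E * bool) : bool := dart_dst d == dart_src d'.

Lemma path_chainE (d : E * bool) s :
  path chain d s = (map (@dart_dst G) (belast d s) == map (@dart_src G) s).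
Proof. by elim: s d => //= d' s IHs d; rewrite IHs eqseq_cons. Qed.

(** Makes the heads of a closed walk a permutation of its tails, whence conservation and
    distinctness of the heads. *)
Lemma cycle_chainE s :
  path.cycle chain s = (map (@dart_dst G) s == rot 1 (map (@dart_src G) s)).
Proof.
case: s => // d s; rewrite /path.cycle path_chainE belast_rcons.
by rewrite map_rcons /= rot1_cons.
Qed.

Definition dart_vec (d : E * bool) : vec :=
  [ffun e => if e == d.1 then sgnb d.2 else 0].

(** Counts darts with multiplicity, so that a closed walk using both darts of an edge still gives a
    flow. *)
Definition walk_sum s : vec := \sum_(d <- s) dart_vec d.

Lemma walk_sum_pair s (g : E -> int) :
  \sum_e walk_sum s e * g e = \sum_(d <- s) sgnb d.2 * g d.1.
Proof.
under eq_bigr do rewrite sum_ffunE mulr_suml.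
rewrite exchange_big /=; apply: eq_bigr => d _.
rewrite (bigD1 d.1) //= ffunE eqxx big1 ?addr0 // => e /negPf ed.
by rewrite ffunE ed mul0r.
Qed.

Lemma cycle_flow s : path.cycle chain s -> flow (walk_sum s).
Proof.
rewrite cycle_chainE => /eqP sE h; rewrite walk_sum_pair.
under eq_bigr do rewrite grad_dart.
rewrite sumrB -(big_map (@dart_dst G) xpredT h) sE.
rewrite -(big_map (@dart_src G) xpredT h).
by rewrite (perm_big (map (@dart_src G) s)) ?subrr // perm_rot.
Qed.

Lemma walk_vecE s : uniq (map fst s) -> walk_vec s = walk_sum s.
Proof.
elim: s => [_|[e b] s IHs /= /andP[es /IHs IH]].
  by rewrite /walk_sum big_nil; apply/ffunP => e; rewrite !ffunE.
rewrite /walk_sum big_cons -/(walk_sum s) -IH; apply/ffunP => e'.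
rewrite !ffunE !in_cons !xpair_eqE /=.
have [->|_] /= := eqVneq e' e; last first.
  by rewrite add0r.
have nes b' : (e, b') \in s = false.
  by apply: contraNF es => eb; apply/mapP; exists (e, b').
by rewrite !nes; case: b.
Qed.

(** [U] collects the vertices reachable from the head of [d0] along [ok] darts; if the tail of [d0]
    is reachable, a path without repeated vertices closes up with [d0]. *)
Lemma reach (ok : pred (E * bool)) (d0 : E * bool) :
  (exists s, [/\ all ok s, path.cycle chain (d0 :: s)
                 & uniq (map (@dart_src G) (d0 :: s))])
  \/ exists U, [/\ dart_dst d0 \in U, dart_src d0 \notin U
       & forall d : E * bool, ok d -> dart_src d \in U -> dart_dst d \in U].
Proof.
pose step u v := [exists d, [&& ok d, dart_src d == u & dart_dst d == v]].
have [cn|ncn] := boolP (connect step (dart_dst d0) (dart_src d0)); last first.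
  right; exists [set v | connect step (dart_dst d0) v].
  split=> [||d okd]; rewrite ?inE ?connect0 // => /connect_trans; apply.
  by apply/connect1/existsP; exists d; rewrite okd !eqxx.
left; have /connectP[p /shortenP[q pq uq _] lastq] := cn.
have lift v r : path step v r -> exists s, [/\ all ok s,
    map (@dart_src G) s = belast v r & map (@dart_dst G) s = r].
  elim: r v => [|x r IHr] v /=; first by exists [::].
  case/andP => /existsP[d /and3P[okd /eqP dv /eqP dx]] /IHr[s [oks src dst]].
  by exists (d :: s); rewrite /= okd oks src dst dv dx.
have [s [oks src dst]] := lift _ _ pq; exists s; split=> //.
  by rewrite cycle_chainE /= rot1_cons src dst lastq -lastI.
by rewrite /= src lastq -rcons_uniq -lastI.
Qed.

(** Painting by darts: an edge with both darts in [ok] is free for [k] and forces [d] to vanish; an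
    edge with neither forces [k] to vanish and is free for [d]. *)
Lemma minty (ok : pred (E * bool)) (d0 : E * bool) :
    ok d0 -> ~~ ok (d0.1, ~~ d0.2) ->
  (exists2 k, flow k & 0 < k d0.1 * sgnb d0.2
     /\ forall e b, ~~ ok (e, b) -> k e * sgnb b <= 0)
  \/ (exists2 d, cutv d & 0 < d d0.1 * sgnb d0.2
     /\ forall e b, ok (e, b) -> 0 <= d e * sgnb b).
Proof.
move=> okd0 nokd0; have [[s [oks cs _]]|[U [dU sU UP]]] := reach ok d0.
  left; exists (walk_sum (d0 :: s)); first exact: cycle_flow.
  have dneg (d : E * bool) e b : ok d -> ~~ ok (e, b) ->
      dart_vec d e * sgnb b <= 0.
    case: d => e' b' okd; rewrite ffunE /=; case: eqP => [->|_]; last by lia.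
    by case: b' okd; case: b => ok1; rewrite ?ok1 ?mulr1 ?mul1r ?mulrN1.
  split=> [|e b okeb].
    rewrite /walk_sum big_cons !ffunE eqxx mulrDl sgnb_sq sum_ffunE ltr_pwDl //.
    rewrite mulr_suml big_seq sumr_ge0 // => d /(allP oks) okd.
    by have := dneg d d0.1 (~~ d0.2) okd nokd0; rewrite sgnbN mulrN oppr_le0.
  rewrite /walk_sum sum_ffunE mulr_suml big_seq sumr_le0 // => d ds.
  apply: dneg => //; move: ds; rewrite in_cons => /predU1P[->//|].
  exact: (allP oks).
have cE (d : E * bool) : cut_vec U d.1 * sgnb d.2
    = (dart_dst d \in U)%:R - (dart_src d \in U)%:R.
  by rewrite mulrC cut_vecE grad_dart.
right; exists (cut_vec U); first exact: cutv_cut_vec.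
split=> [|e b /UP]; first by rewrite cE dU (negPf sU).
rewrite (cE (e, b)); case: (_ \in U) => [->//|_]; rewrite subr0.
by case: (_ \in U).
Qed.

Lemma walk_vec_unit s : unit_valued (walk_vec s).
Proof.
move=> e; rewrite ffunE; case: ifP => _; first by constructor 2.
by case: ifP => _; [constructor 3 | constructor 1].
Qed.

Lemma walk_vec_supp s e : (walk_vec s e != 0) = (e \in map fst s).
Proof.
rewrite ffunE; apply/idP/mapP => [|[[e' []] es -> /=]].
- case: ifP => [es _|_]; first by exists (e, true).
  by case: ifP => // es _; exists (e, false).
- by rewrite es.
- by rewrite es; case: ifP.
Qed.

Lemma directed_cycleP w :
  directed_cycle w -> [/\ flow w, unit_valued w & w != 0].
Proof.
case=> s /and4P[s0 cs _ us] ->; split; last first.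
- case: s s0 {cs us} => // d s _; apply/eqP => w0.
  by have := walk_vec_supp (d :: s) d.1; rewrite w0 !inE ffunE !eqxx.
- exact: walk_vec_unit.
- by rewrite walk_vecE //; exact: cycle_flow.
Qed.

(** Follow the darts along which [k] is positive. If they do not lead back, they enter a vertex set
    without leaving it, against orthogonality of [k] to its cut vector. *)
Lemma flow_conformal_cycle k : flow k -> k != 0 ->
  exists2 w, directed_cycle w & conformal w k.
Proof.
move=> fk k0; pose ok d := 0 < k d.1 * sgnb d.2.
have okN e b : ok (e, b) -> b = (0 < k e).
  by rewrite /ok /sgnb; case: b; rewrite /= ?mulr1 ?mulrN1; lia.
have [e0 ke0] : exists e, k e != 0.
  apply: contrapT => H; case/eqP: k0; apply/ffunP => e; rewrite ffunE.
  by apply: contrapT => ke; apply: H; exists e; apply/eqP.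
pose d0 := (e0, 0 < k e0); have okd0 : ok d0.
  by rewrite /ok /d0 /sgnb /=; case: ifP; rewrite ?mulr1 ?mulrN1; lia.
have [[s [oks cs us]]|[U [dU sU UP]]] := reach ok d0.
  have okd : all ok (d0 :: s) by rewrite /= okd0.
  have ufst : uniq (map fst (d0 :: s)).
    rewrite map_inj_in_uniq ?(map_uniq us) // => -[e b] [e' b'].
    by move=> /(allP okd)/okN /= -> /(allP okd)/okN /= -> /= ->.
  exists (walk_vec (d0 :: s)).
    by exists (d0 :: s); rewrite // /closed_simple_walk cs us ufst.
  move=> e; rewrite ffunE; case: ifP => [/(allP okd)|_].
    by rewrite /ok mulr1 mul1r.
  by case: ifP => // /(allP okd); rewrite /ok mulrN1 mulN1r.
have := flow_orth fk (cutv_cut_vec U).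
have cE e b : k e * cut_vec U e = (k e * sgnb b) *
    ((dart_dst (e, b) \in U)%:R - (dart_src (e, b) \in U)%:R).
  rewrite -(grad_dart (fun v => (v \in U)%:R)) -cut_vecE.
  by rewrite mulrA -(mulrA (k e)) sgnb_sq mulr1.
have pos e : 0 <= k e * cut_vec U e.
  have [->|ke] := eqVneq (k e) 0; first by rewrite mul0r.
  have oke : ok (e, 0 < k e).
    by rewrite /ok /sgnb /=; case: ifP; rewrite ?mulr1 ?mulrN1; lia.
  rewrite (cE e (0 < k e)); apply: mulr_ge0; first exact: ltW.
  by have := UP _ oke; case: (_ \in U) => [->//|_]; case: (_ \in U).
move/eqP; rewrite psumr_eq0 // => /allP/(_ e0 (mem_index_enum _)) /=.
rewrite (cE e0 (0 < k e0)) dU (negPf sU) subr0 mulr1 => /eqP k00.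
by move: okd0; rewrite /ok k00 ltxx.
Qed.

End Graph.

Arguments chain {G}.

(** * Simple cycles and minimal cuts *)

Section Elementary.
Variable G : multigraph.
Local Notation V := (vertex G).
Local Notation E := (edge G).
Local Notation vec := {ffun E -> int}.
Implicit Types (k w c : vec) (A F T : {set E}) (U : {set V}).

Lemma sum_delta (I : eqType) (J : eqType) (s : seq I) (f : I -> J)
    (g : I -> int) a :
  uniq (map f s) -> a \in s -> \sum_(i <- s) g i * (f i == f a)%:R = g a.
Proof.
elim: s => // x s IHs /= /andP[xs us]; rewrite big_cons in_cons.
case/predU1P => [->|sa]; last first.
  rewrite IHs //; case: eqP => [fxa|_]; last by rewrite mulr0 add0r.
  by case/negP: xs; rewrite fxa map_f.
rewrite eqxx mulr1 big_seq big1 ?addr0 // => i si.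
case: eqP => [fix_|_]; last by rewrite mulr0.
by case/negP: xs; rewrite -fix_ map_f.
Qed.

(* By conservation at its vertices, a flow carried by a simple cycle has
   constant value along it. *)
Lemma cycle_flow_eq0 (s : seq (E * bool)) k (d0 : E * bool) :
    closed_simple_walk s -> flow k ->
    (forall e, e \notin map fst s -> k e = 0) -> d0 \in s -> k d0.1 = 0 -> k = 0.
Proof.
move=> /and4P[_ cs usrc ufst] fk ks sd0 kd0.
pose kd (d : E * bool) := k d.1 * sgnb d.2.
have udst : uniq (map (@dart_dst G) s).
  by move: cs; rewrite -/chain cycle_chainE => /eqP->; rewrite rot_uniq.
(* Pairing [k] with the gradient of the indicator of the common vertex leaves only the terms of [a]
   and [b]. *)
have kdE a b : a \in s -> b \in s -> chain a b -> kd a = kd b.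
  move=> sa sb /eqP ab; apply/eqP; rewrite -subr_eq0; apply/eqP.
  rewrite -[RHS](fk (fun v => (v == dart_src b)%:R)).
  rewrite -{1}(sum_delta kd udst sa) -(sum_delta kd usrc sb) -sumrB ab.
  rewrite [RHS](bigID (fun e => e \in map fst s)) /=.
  rewrite [X in _ = _ + X]big1 ?addr0; last first.
    by move=> e /ks->; rewrite mul0r.
  rewrite -big_uniq // big_map; apply: eq_bigr => d _.
  rewrite -mulrBr -(grad_dart (fun v => (v == dart_src b)%:R)).
  by rewrite /kd mulrA -(mulrA (k _)) sgnb_sq mulr1.
have kd0' p (x : E * bool) :
    path chain x p -> {subset x :: p <= s} -> kd x = 0 ->
    forall y, y \in x :: p -> kd y = 0.
  elim: p x => [|z p IHp] x /=; first by move=> _ _ kx y; rewrite inE => /eqP->.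
  case/andP=> xz zp sub kx y; rewrite in_cons => /predU1P[->//|].
  apply: IHp => // [y' y'p|]; first by apply: sub; rewrite in_cons y'p orbT.
  by rewrite -(kdE x) // sub // !inE eqxx ?orbT.
have [i s' rs] := rot_to sd0.
apply/ffunP => e; rewrite [RHS]ffunE.
have [/mapP[d sd ->]|/ks//] := boolP (e \in map fst s).
have : kd d = 0.
  apply: (kd0' s' d0); rewrite /kd ?kd0 ?mul0r // -?rs ?mem_rot //.
    by move: cs; rewrite -/chain -(rot_cycle i) rs /= rcons_path => /andP[].
  by move=> y; rewrite mem_rot.
by rewrite /kd; case: d.2; rewrite ?mulr1 ?mulrN1; lia.
Qed.

Lemma in_support (w : vec) e : (e \in support_of w) = (w e != 0).
Proof. by rewrite inE. Qed.

(** At one edge of the cycle the vectors agree or are opposite; their difference or sum is then a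
    flow on the cycle that vanishes there. *)
Lemma directed_cycle_eq w w' : directed_cycle w -> directed_cycle w' ->
  support_of w = support_of w' -> w = w' \/ w = - w'.
Proof.
move=> dw dw'; have [fw wu w0] := directed_cycleP dw.
have [fw' wu' _] := directed_cycleP dw'.
case: dw => s cs ws supp.
have supE e : (e \notin map fst s) -> w e = 0 /\ w' e = 0.
  rewrite -walk_vec_supp -ws => we; have := in_support w' e.
  rewrite -supp in_support (negPf we) => /esym/negbFE/eqP.
  by move/negPn/eqP: we.
have [[e b] [s' sE]] : exists d s', s = d :: s'.
  by case: (s) cs => // d s' _; exists d, s'.
have es : e \in map fst s by rewrite sE inE eqxx.
have dich (c : vec) : flow c -> (forall e, e \notin map fst s -> c e = 0) ->
    c e = 0 -> c = 0.
  have sd0 : (e, b) \in s by rewrite sE inE eqxx.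
  by move=> fc c0 ce; exact: cycle_flow_eq0 cs fc c0 sd0 ce.
have we : w e != 0 by rewrite ws walk_vec_supp.
have w'e : w' e != 0 by rewrite -in_support -supp in_support.
have [E1|E1] : w e = w' e \/ w e = - w' e.
  by case: (wu e) we => -> //; case: (wu' e) w'e => -> //; rewrite ?opprK; auto.
- left; apply/subr0_eq/dich; first exact: (@flow_additive G).2.
    by move=> e' /supE[we' w'e']; rewrite !ffunE we' w'e'.
  by rewrite !ffunE E1 subrr.
- right; apply/eqP; rewrite -addr_eq0; apply/eqP/dich.
  + exact: (additive_predD (@flow_additive G)).
  + by move=> e' /supE[we' w'e']; rewrite !ffunE we' w'e'.
  + by rewrite !ffunE E1 addNr.
Qed.

Hypothesis connG : connected_graph G.

Lemma cut_eq0 U : cut U = set0 -> U = set0 \/ U = [set: V].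
Proof.
move=> cU; have h0 e : e \in [set: E] -> grad (fun v => (v \in U)%:R) e = 0.
  move=> _; have /setP/(_ e) := cU; rewrite !inE ffunE => /negbFE/eqP->.
  by rewrite subrr.
have UE := grad_const connG h0.
have [->|[u uU]] := set_0Vmem U; [by left|right].
apply/setP => v; rewrite !inE; have := UE u v; rewrite uU.
by case: (v \in U).
Qed.

Lemma support_cut_vec U : support_of (cut_vec U) = cut U.
Proof.
by apply/setP => e; rewrite !inE ffunE; case: (_ \in U); case: (_ \in U).
Qed.

Lemma cut_vec_unit U : unit_valued (cut_vec U).
Proof.
by move=> e; rewrite ffunE; case: (_ \in U); case: (_ \in U);
  rewrite ?subrr ?subr0 ?sub0r;
  [constructor 1|constructor 2|constructor 3|constructor 1].
Qed.

Lemma cut_vec_setC U : cut_vec (~: U) = - cut_vec U.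
Proof.
by apply/ffunP => e; rewrite !ffunE !inE; case: (_ \in U); case: (_ \in U).
Qed.

Lemma directed_cocycleP w :
  directed_cocycle w -> [/\ cutv w, unit_valued w & w != 0].
Proof.
case=> -[[W [W0 WT WE]] _] [U wU]; split.
- by rewrite wU; exact: cutv_cut_vec.
- by rewrite wU; exact: cut_vec_unit.
- apply/eqP => w0; suff /cut_eq0[/eqP|/eqP] : cut W = set0.
  + by rewrite (negPf W0).
  + by rewrite (negPf WT).
  by rewrite -WE w0; apply/setP => e; rewrite !inE ffunE eqxx.
Qed.

(** An edge joining [U :&: W] to [U :\: W] would lie in [cut W] but not in [cut U]. *)
Lemma cut_setI_sub U W : cut W \subset cut U -> cut (U :&: W) \subset cut U.
Proof.
move=> /subsetP WU; apply/subsetP => e; have := WU e.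
rewrite !inE.
by case: (_ \in U); case: (_ \in W); case: (_ \in U); case: (_ \in W) => //
  /(_ isT).
Qed.

Lemma cut_vec_setI U W e : cut W \subset cut U ->
  cut_vec (U :&: W) e != 0 -> cut_vec (U :&: W) e = cut_vec U e.
Proof.
move=> /subsetP/(_ e); rewrite !inE !ffunE !inE.
by case: (_ \in U); case: (_ \in W); case: (_ \in U); case: (_ \in W) => //
  /(_ isT).
Qed.

Lemma cut_setC U : cut (~: U) = cut U.
Proof.
by apply/setP => e; rewrite !inE; case: (_ \in U); case: (_ \in U).
Qed.

Lemma conformal_setC U c :
  conformal (cut_vec (~: U)) (- c) <-> conformal (cut_vec U) c.
Proof.
have UN e : cut_vec (~: U) e = - cut_vec U e by rewrite cut_vec_setC ffunE.
have cN e : (- c) e = - c e by rewrite ffunE.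
by split=> Uc e; have := Uc e; rewrite UN cN oppr_eq0 mulrNN.
Qed.

(** Minimal in size, and only among directed cuts; [minimal_directed_cut_cocycle] upgrades this to
    inclusion-minimality among all cuts. *)
Definition minimal_directed_cut c U : Prop :=
  [/\ U != set0, U != [set: V], conformal (cut_vec U) c
    & forall U', U' != set0 -> U' != [set: V] ->
      conformal (cut_vec U') c -> (#|cut U| <= #|cut U'|)%N].

(* [U] is the union of [U :&: W] and [U :\: W], whose cuts are disjoint and
   directed as [cut U]. *)
Lemma minimal_directed_cut_split c U W :
    minimal_directed_cut c U -> cut W \subset cut U ->
  U :&: W = set0 \/ U \subset W.
Proof.
move=> [U0 UT Uc minU] WU.
have [->|X0] := eqVneq (U :&: W) set0; [by left|right].
rewrite -setD_eq0 setDE; apply: contraT => Y0.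
(* By minimality both parts of [U] have the cut of [U]; but an edge of [cut U] has a single end in
   [U], hence meets one part only. *)
have eqU (W' : {set V}) : cut W' \subset cut U -> U :&: W' != set0 ->
    cut (U :&: W') = cut U.
  move=> W'U X'0; apply/eqP; rewrite eqEcard cut_setI_sub // minU //.
    apply: contra UT => /eqP UW; rewrite -subTset -UW; exact: subsetIl.
  by move=> e Xe; rewrite (cut_vec_setI W'U Xe) Uc // -(cut_vec_setI W'U Xe).
have := eqU _ WU X0; have := eqU (~: W); rewrite cut_setC => /(_ WU Y0) YE XE.
have [/cut_eq0[/eqP|/eqP]|[e]] := set_0Vmem (cut U).
- by rewrite (negPf U0).
- by rewrite (negPf UT).
move=> eU; have := eU; rewrite -{1}XE; have := eU; rewrite -{1}YE; move: eU.
rewrite !inE.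
by case: (_ \in U); case: (_ \in W); case: (_ \in U); case: (_ \in W).
Qed.

Lemma minimal_directed_cutC c U :
  minimal_directed_cut c U -> minimal_directed_cut (- c) (~: U).
Proof.
move=> [U0 UT Uc minU]; split.
- by rewrite -setCT (inj_eq (@setC_inj _)).
- by rewrite -setC0 (inj_eq (@setC_inj _)).
- exact/conformal_setC.
move=> U' U'0 U'T U'c; rewrite cut_setC -(cut_setC U'); apply: minU.
- by rewrite -setCT (inj_eq (@setC_inj _)).
- by rewrite -setC0 (inj_eq (@setC_inj _)).
- by apply/conformal_setC; rewrite setCK.
Qed.

(** Splitting [U] by [W] and the complement of [U] by that of [W] leaves only [W = U] and
    [W = ~: U], as [W] is neither empty nor full. *)
Lemma minimal_directed_cut_cocycle c U :
  minimal_directed_cut c U -> directed_cocycle (cut_vec U).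
Proof.
move=> mU; have [U0 UT _ _] := mU; split; last by exists U.
rewrite support_cut_vec; split; first by exists U.
move=> _ [W [W0 WT ->]] WU.
have spl := minimal_directed_cut_split mU WU.
have := minimal_directed_cut_split (minimal_directed_cutC mU) (W := ~: W).
rewrite !cut_setC setCS => /(_ WU) spl'.
have [UW|UW] := spl; have [CW|WU'] := spl'.
- suff -> : W = ~: U by rewrite cut_setC.
  apply/setP => v; have /setP/(_ v) := UW; have /setP/(_ v) := CW.
  by rewrite !inE; case: (v \in U); case: (v \in W).
- case/eqP: W0; apply/setP => v; have /setP/(_ v) := UW.
  have := subsetP WU' v; rewrite !inE.
  by case: (v \in U); case: (v \in W) => // /(_ isT).
- case/eqP: WT; apply/setP => v; have /setP/(_ v) := CW.
  have := subsetP UW v; rewrite !inE.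
  by case: (v \in U); case: (v \in W) => // /(_ isT).
- by congr cut; apply/eqP; rewrite eqEsubset WU' UW.
Qed.

Lemma cutv_conformal_cocycle c : cutv c -> c != 0 ->
  exists2 w, directed_cocycle w & conformal w c.
Proof.
move=> [h cE] c0.
pose good U := [&& U != set0, U != [set: V] &
  [forall e, (cut_vec U e != 0) ==> (0 < cut_vec U e * c e)]].
have conformalP U : reflect (conformal (cut_vec U) c)
    [forall e, (cut_vec U e != 0) ==> (0 < cut_vec U e * c e)].
  by apply: (iffP forallP) => Uc e; [exact: (implyP (Uc e))|exact/implyP/Uc].
have [U0 gU0] : exists U, good U.
  have [e ce] : exists e, c e != 0.
    apply: contrapT => H; case/eqP: c0; apply/ffunP => e; rewrite ffunE.
    by apply: contrapT => ce; apply: H; exists e; apply/eqP.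
  (* A superlevel set of [h] has its cut directed as [grad h]; at this threshold it contains exactly
     one end of [e]. *)
  pose t := Num.max (h (ehead e)) (h (etail e)).
  exists [set v | t <= h v]; apply/and3P; split.
  - apply/set0Pn; rewrite /t; case: leP => _;
      [exists (etail e)|exists (ehead e)]; by rewrite inE.
  - apply/eqP => /setP UT; have := UT (ehead e); have := UT (etail e).
    by move: ce; rewrite !inE cE ffunE /t; lia.
  - apply/forallP => e'; apply/implyP.
    by rewrite cE !ffunE !inE; case: leP; case: leP => //; lia.
case: (arg_minnP (fun U => #|cut U|) gU0) => U.
move=> /and3P[UO UT /conformalP Uc] minU.
exists (cut_vec U) => //; apply: (minimal_directed_cut_cocycle (c := c)).
by split=> // U' U'0 U'T /conformalP U'c; apply: minU; exact/and3P.
Qed.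

(** The symmetric difference of the two vertex sets has empty cut, so by connectivity the sets are
    equal or complementary. *)
Lemma directed_cocycle_eq w w' : directed_cocycle w -> directed_cocycle w' ->
  support_of w = support_of w' -> w = w' \/ w = - w'.
Proof.
move=> [_ [U ->]] [_ [U' ->]]; rewrite !support_cut_vec => /setP UU'.
pose W := [set v | (v \in U) != (v \in U')].
have cW : cut W = set0.
  apply/setP => e; have := UU' e; rewrite !inE.
  by case: (_ \in U); case: (_ \in U); case: (_ \in U'); case: (_ \in U').
have [W0|WT] := cut_eq0 cW; [left|right].
  congr cut_vec; apply/setP => v; have /setP/(_ v) := W0.
  by rewrite !inE => /negbFE/eqP.
rewrite -cut_vec_setC; congr cut_vec; apply/setP => v; have /setP/(_ v) := WT.
by rewrite !inE; case: (_ \in U); case: (_ \in U').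
Qed.

End Elementary.

(** * Fundamental cycles and cocycles; trees of a signed minor *)

Section Trees.
Variable G : multigraph.
Local Notation V := (vertex G).
Local Notation E := (edge G).
Local Notation vec := {ffun E -> int}.
Implicit Types (k w c : vec) (A F T : {set E}) (s : E -> bool).
Variables sigma sigma' : {set E} -> vec.
Hypotheses (connG : connected_graph G)
  (sig : cycle_signature sigma) (sig' : cocycle_signature sigma')
  (Ksig : pointed (@is_cycle G) sigma) (Ksig' : pointed (@is_cocycle G) sigma').

Local Notation K := (cone (@is_cycle G) sigma).
Local Notation K' := (cone (@is_cocycle G) sigma').
Local Notation fc T e := (sigma (fund_cycle T e)).
Local Notation fd T e := (sigma' (fund_cocycle T e)).

Lemma forest_flow_eq0 F k : spanning_forest F -> flow k ->
  (forall e, e \notin F -> k e = 0) -> k = 0.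
Proof.
move=> forF fk kF; apply/eqP; apply: contraT => k0.
have [w dw wk] := flow_conformal_cycle fk k0.
have /forF/negP[] : is_cycle (support_of w) by exists w.
apply/subsetP => e; rewrite in_support => we; apply: contraT => /kF ke.
by have := wk e we; rewrite ke mulr0 ltxx.
Qed.

Lemma sgnb_le0 (x : int) : (forall b, x * sgnb b <= 0) -> x = 0.
Proof.
by move=> H; have := H true; have := H false; rewrite mulrN1 mulr1; lia.
Qed.

Lemma sgnb_ge0 (x : int) : (forall b, 0 <= x * sgnb b) -> x = 0.
Proof.
by move=> H; have := H true; have := H false; rewrite mulrN1 mulr1; lia.
Qed.

(** Paint both darts of each edge of [T] and one dart of [e]: a cut vector from [minty] would vanish
    on [T], hence everywhere, so there is a flow through [e] supported on [e |: T]. *)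
Lemma fund_cycleP T e : spanning_tree T -> e \notin T ->
  is_cycle (fund_cycle T e) /\ fund_cycle T e \subset e |: T.
Proof.
move=> [forT conT] eT; apply: (xgetPex set0
  (P := [set C : {set E} | is_cycle C /\ C \subset e |: T]%classic)).
pose ok (d : E * bool) := (d.1 \in T) || (d == (e, true)).
have [||[k fk [ke ksup]]|[c cc [ce cpos]]] := @minty G ok (e, true).
- by rewrite /ok eqxx orbT.
- by rewrite /ok negb_or eT xpair_eqE andbF.
- have k0 : k != 0 by apply: contraTneq ke => ->; rewrite ffunE mul0r ltxx.
  have [w dw wk] := flow_conformal_cycle fk k0.
  exists (support_of w); split; first by exists w.
  apply/subsetP => e'; rewrite in_support => we'; rewrite !inE.
  apply: contraT; rewrite negb_or => /andP[e'e e'T].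
  have := wk e' we'; rewrite (sgnb_le0 (x := k e')) ?mulr0 ?ltxx // => b.
  by apply: ksup; rewrite /ok /= negb_or e'T xpair_eqE negb_and e'e.
- move: ce; rewrite (cutv_eq0 conT cc) ?ffunE ?mul0r // => e' e'T.
  by apply: sgnb_ge0 => b; apply: cpos; rewrite /ok /= e'T.
Qed.

Lemma fund_cocycleP T e : spanning_tree T -> e \in T ->
  is_cocycle (fund_cocycle T e) /\ fund_cocycle T e \subset e |: ~: T.
Proof.
move=> [forT conT] eT; apply: (xgetPex set0
  (P := [set C : {set E} | is_cocycle C /\ C \subset e |: ~: T]%classic)).
pose ok (d : E * bool) := (d.1 \in T :\ e) || (d == (e, true)).
have [||[k fk [ke ksup]]|[c cc [ce cpos]]] := @minty G ok (e, true).
- by rewrite /ok eqxx orbT.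
- by rewrite /ok negb_or !inE eqxx xpair_eqE andbF.
- move: ke; rewrite (forest_flow_eq0 forT fk) ?ffunE ?mul0r // => e' e'T.
  apply: sgnb_le0 => b; apply: ksup; rewrite /ok /= !inE (negPf e'T) andbF /=.
  by rewrite xpair_eqE negb_and eq_sym (memPn e'T).
- have c0 : c != 0 by apply: contraTneq ce => ->; rewrite ffunE mul0r ltxx.
  have [w dw wc] := cutv_conformal_cocycle connG cc c0.
  exists (support_of w); split; first by case: dw.
  apply/subsetP => e'; rewrite in_support => we'; rewrite !inE.
  apply: contraT; rewrite negb_or negbK => /andP[e'e e'T].
  have := wc e' we'; rewrite (sgnb_ge0 (x := c e')) ?mulr0 ?ltxx // => b.
  by apply: cpos; rewrite /ok /= !inE e'e e'T.
Qed.

(** Supplies the hypotheses of [cone_expand] with [S = ~: T]. The entry at [e] is nonzero, since the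
    forest [T] contains no cycle. *)
Lemma fcP T e : spanning_tree T -> e \notin T ->
  [/\ flow (fc T e), K (fc T e), fc T e e = 1 \/ fc T e e = -1
    & forall e', e' \notin T -> e' != e -> fc T e e' = 0].
Proof.
move=> trT eT; have [cyc /subsetP sub] := fund_cycleP trT eT.
have [/directed_cycleP[fw wu w0] supp] := sig cyc.
have out e' : e' \notin T -> e' != e -> fc T e e' = 0.
  move=> e'T e'e; apply/eqP; rewrite -[_ == 0]negbK -in_support supp.
  by apply: contraNN e'T => /sub; rewrite !inE (negPf e'e).
split=> //; first exact: cone_gen.
case: (wu e); auto => we0; case/eqP: w0.
apply: (forest_flow_eq0 trT.1 fw) => e' e'T.
by have [->//|] := eqVneq e' e; exact: out.
Qed.

Lemma fdP T e : spanning_tree T -> e \in T ->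
  [/\ cutv (fd T e), K' (fd T e), fd T e e = 1 \/ fd T e e = -1
    & forall e', e' \in T -> e' != e -> fd T e e' = 0].
Proof.
move=> trT eT; have [cyc /subsetP sub] := fund_cocycleP trT eT.
have [/(directed_cocycleP connG)[cw wu w0] supp] := sig' cyc.
have out e' : e' \in T -> e' != e -> fd T e e' = 0.
  move=> e'T e'e; apply/eqP; rewrite -[_ == 0]negbK -in_support supp.
  by apply: contraTN e'T => /sub; rewrite !inE (negPf e'e).
split=> //; first exact: cone_gen.
case: (wu e); auto => we0; case/eqP: w0.
apply: (cutv_eq0 trT.2 cw) => e' e'T.
by have [->//|] := eqVneq e' e; exact: out.
Qed.

Lemma flow_cone T k : spanning_tree T -> flow k ->
  (forall e, e \notin T -> 0 <= k e * fc T e e) -> K k.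
Proof.
move=> trT fk kpos.
apply: (cone_expand (Q := @flow G) (S := ~: T) (f := fun e => fc T e)) => //.
- exact: flow_additive.
- move=> k' fk' k'0; apply: (forest_flow_eq0 trT.1 fk') => e eT.
  by apply: k'0; rewrite inE.
- move=> e; rewrite inE => eT; have [? ? ? out] := fcP trT eT; split=> // e'.
  by rewrite inE; exact: out.
- by move=> e; rewrite inE; exact: kpos.
Qed.

Lemma cutv_cone T c : spanning_tree T -> cutv c ->
  (forall e, e \in T -> 0 <= c e * fd T e e) -> K' c.
Proof.
move=> trT cc cpos.
apply: (cone_expand (Q := @cutv G) (S := T) (f := fun e => fd T e)) => //.
- exact: cutv_additive.
- by move=> c' cc' c'0; exact: (cutv_eq0 trT.2 cc').
- by move=> e eT; exact: fdP.
Qed.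

(* [s] orients every edge of [A :\: T] as its fundamental cycle and every edge
   of [T :\: F] as its fundamental cocycle: in the minor [A / F], the tree
   [T :\: F] is sent to [s] by the bijection of Backman, Baker and Yuen. *)
Definition tree_of A F s T : Prop :=
  [/\ spanning_tree T, F \subset T /\ T \subset A,
      forall e, e \in A -> e \notin T -> fc T e e = sgnb (s e)
    & forall e, e \in T -> e \notin F -> fd T e e = sgnb (s e)].

Lemma tree_of_sub A F s T1 T2 :
  tree_of A F s T1 -> tree_of A F s T2 -> T1 \subset T2.
Proof.
move=> [tr1 [/subsetP F1 /subsetP A1] c1 d1].
move=> [tr2 [/subsetP F2 /subsetP A2] c2 d2].
apply/subsetP => e0 e01; apply: contraT => e02.
(* Common edges get both darts, edges in neither tree none; [T1 :\: T2] is painted against [s],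
   [T2 :\: T1] along [s]. The two trees then put [k] and [- k], or [- c] and [c], in the cone. *)
pose ok (d : E * bool) := if d.1 \in T1 then (d.1 \in T2) || (d.2 != s d.1)
                          else (d.1 \in T2) && (d.2 == s d.1).
have [||[k fk [ke kP]]|[c cc [ce cP]]] := @minty G ok (e0, ~~ s e0).
- by rewrite /ok /= e01 (negPf e02); case: (s e0).
- by rewrite /ok /= e01 (negPf e02) negbK eqxx.
- have k0 e : (e \in T1) = (e \in T2) -> e \notin T1 -> k e = 0.
    move=> e12 e1; apply: sgnb_le0 => b; apply: kP.
    by rewrite /ok /= -e12 (negPf e1).
  have K1 : K k.
    apply: (flow_cone tr1 fk) => e e1.
    have [e2|e2] := boolP (e \in T2); last first.
      by rewrite (k0 e) ?mul0r // (negPf e1) (negPf e2).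
    rewrite (c1 _ (A2 _ e2) e1); have := kP e (~~ s e).
    rewrite /ok /= (negPf e1) e2 sgnbN mulrN oppr_le0; apply.
    by case: (s e).
  have K2 : K (- k).
    apply: (flow_cone tr2); first exact: additive_predN (@flow_additive G) fk.
    move=> e e2; rewrite ffunE mulNr oppr_ge0.
    have [e1|e1] := boolP (e \in T1); last first.
      by rewrite (k0 e) ?mul0r // (negPf e1) (negPf e2).
    rewrite (c2 _ (A1 _ e1) e2); apply: kP.
    by rewrite /ok /= e1 (negPf e2) eqxx.
  by move: ke; rewrite (Ksig K1 K2) ffunE mul0r ltxx.
- have c0 e : e \in T1 -> e \in T2 -> c e = 0.
    move=> e1 e2; apply: sgnb_ge0 => b; apply: cP.
    by rewrite /ok /= e1 e2.
  have K1 : K' (- c).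
    apply: (cutv_cone tr1); first exact: additive_predN (@cutv_additive G) cc.
    move=> e e1; rewrite ffunE mulNr oppr_ge0.
    have [e2|e2] := boolP (e \in T2); first by rewrite c0 // mul0r.
    rewrite d1 //; last by apply: contra e2 => /F2.
    have := cP e (~~ s e); rewrite /ok /= e1 (negPf e2) sgnbN mulrN oppr_ge0.
    by apply; case: (s e).
  have K2 : K' c.
    apply: (cutv_cone tr2 cc) => e e2.
    have [e1|e1] := boolP (e \in T1); first by rewrite c0 // mul0r.
    rewrite d2 //; last by apply: contra e1 => /F1.
    by apply: cP; rewrite /ok /= (negPf e1) e2 eqxx.
  by move: ce; rewrite (Ksig' K2 K1) ffunE mul0r ltxx.
Qed.

Lemma tree_of_inj A F s T1 T2 :
  tree_of A F s T1 -> tree_of A F s T2 -> T1 = T2.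
Proof.
move=> t1 t2; apply/eqP.
by rewrite eqEsubset (tree_of_sub t1 t2) (tree_of_sub t2 t1).
Qed.

(** The tree of the contraction does not see [s e], so the orientation of [e] may be chosen to fit
    it. [tree_of_exists] uses this also with [e] reversed. *)
Lemma tree_of_contract A F s s' e T :
    tree_of A (e |: F) s T -> (forall f, f != e -> s' f = s f) ->
  fd T e e = sgnb (s' e) -> tree_of A F s' T.
Proof.
move=> [trT [FT TA] cT dT] ss' de; have eT : e \in T.
  by apply: (subsetP FT); rewrite !inE eqxx.
split=> // [|f fA fT|f fT fF].
- by split=> //; apply: subset_trans FT; exact: subsetUr.
- by rewrite ss' ?cT //; apply: contraNneq fT => ->.
- have [->//|fe] := eqVneq f e.
  by rewrite ss' // dT // !inE negb_or fe.
Qed.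

Lemma tree_of_delete A F s s' e T :
    tree_of (A :\ e) F s T -> (forall f, f != e -> s' f = s f) ->
  fc T e e = sgnb (s' e) -> tree_of A F s' T.
Proof.
move=> [trT [FT TA] cT dT] ss' ce; split=> // [|f fA fT|f fT fF].
- by split=> //; apply: subset_trans TA _; exact: subsetDl.
- have [->//|fe] := eqVneq f e.
  by rewrite ss' // cT // !inE fe.
- rewrite ss' ?dT //; apply: contraTneq fT => ->; apply/negP => /(subsetP TA).
  by rewrite !inE eqxx.
Qed.

(** Cone form of the condition that all directed cycles of [s] in [A / F] agree with [sigma]; flows
    of the minor are unconstrained on [F]. *)
Definition cycle_admissible A F s : Prop := forall k, flow k ->
  (forall e, e \notin A -> k e = 0) ->
  (forall e, e \in A -> e \notin F -> 0 <= k e * sgnb (s e)) -> K k.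

Definition cocycle_admissible A F s : Prop := forall c, cutv c ->
  (forall e, e \in F -> c e = 0) ->
  (forall e, e \in A -> e \notin F -> 0 <= c e * sgnb (s e)) -> K' c.

(** Contraction lifts the sign condition at [e] only, so an obstruction must violate it there. *)
Lemma not_cycle_admissibleU1 A F s e :
    cycle_admissible A F s -> ~ cycle_admissible A (e |: F) s ->
  exists k, [/\ flow k, ~ K k, forall f, f \notin A -> k f = 0,
    forall f, f \in A -> f \notin F -> f != e -> 0 <= k f * sgnb (s f)
    & k e * sgnb (s e) < 0].
Proof.
move=> adm /existsNP[k /not_implyP[fk /not_implyP[kA /not_implyP[kF nK]]]].
have kF' f : f \in A -> f \notin F -> f != e -> 0 <= k f * sgnb (s f).
  by move=> fA fF fe; apply: kF; rewrite // !inE negb_or fe.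
exists k; split=> //; rewrite ltNge; apply/negP => ke; apply: nK.
apply: adm => // f fA fF; have [->//|fe] := eqVneq f e; exact: kF'.
Qed.

Lemma not_cocycle_admissibleD1 A F s e :
    cocycle_admissible A F s -> ~ cocycle_admissible (A :\ e) F s ->
  exists c, [/\ cutv c, ~ K' c, forall f, f \in F -> c f = 0,
    forall f, f \in A -> f \notin F -> f != e -> 0 <= c f * sgnb (s f)
    & c e * sgnb (s e) < 0].
Proof.
move=> adm /existsNP[c /not_implyP[cc /not_implyP[cF /not_implyP[cA nK]]]].
have cA' f : f \in A -> f \notin F -> f != e -> 0 <= c f * sgnb (s f).
  by move=> fA fF fe; apply: cA; rewrite // !inE fe.
exists c; split=> //; rewrite ltNge; apply/negP => ce; apply: nK.
apply: adm => // f fA fF; have [->//|fe] := eqVneq f e; exact: cA'.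
Qed.

Lemma mul_sgnb (x y : int) b : x * y = (x * sgnb b) * (y * sgnb b).
Proof. by rewrite mulrACA sgnb_sq mulr1. Qed.

(* Orthogonality: the obstructions to contracting and to deleting [e] are a
   flow and a cut vector whose product is nonnegative everywhere and positive
   at [e]. *)
Lemma admissible_minor A F s e :
    cycle_admissible A F s -> cocycle_admissible A F s ->
  ~ cycle_admissible A (e |: F) s -> cocycle_admissible (A :\ e) F s.
Proof.
move=> adC adD /(not_cycle_admissibleU1 adC)[k [fk _ kA kF ke]].
apply: contrapT => /(not_cocycle_admissibleD1 adD)[c [cc _ cF cA ce]].
have pos f : 0 <= k f * c f.
  have [->|fe] := eqVneq f e.
    by rewrite (mul_sgnb _ _ (s e)) mulr_le0 ?ltW.
  have [fF|fF] := boolP (f \in F); first by rewrite cF // mulr0.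
  have [fA|fA] := boolP (f \in A); last by rewrite kA // mul0r.
  by rewrite (mul_sgnb _ _ (s f)) mulr_ge0 ?kF ?cA.
have /eqP := flow_orth fk cc; rewrite psumr_eq0 // => /allP/(_ e (mem_index_enum _)).
rewrite /= (mul_sgnb _ _ (s e)) => /eqP ke0.
by have := nmulr_lgt0 (k e * sgnb (s e)) ce; rewrite ke0 ltxx ke.
Qed.

Lemma pm1_sgnb (x : int) b : x = 1 \/ x = -1 -> x <> sgnb b -> x = - sgnb b.
Proof. by case=> ->; case: b => // _; rewrite opprK. Qed.

(** Induction on [#|A :\: F|]. Each admissible minor at an edge [e] yields a tree; the point is that
    one of these trees also orients [e] as [s]. *)
Lemma tree_of_exists A F s :
    F \subset A -> spanning_forest F -> connected_by A ->
    cycle_admissible A F s -> cocycle_admissible A F s ->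
  exists T, tree_of A F s T.
Proof.
have [n] := ubnP #|A :\: F|; elim: n A F => // n IHn A F.
rewrite ltnS => nAF FA forF conA adC adD.
have [AF|[e]] := set_0Vmem (A :\: F).
  have {FA} AF : A = F by apply/eqP; rewrite eqEsubset FA -setD_eq0 AF eqxx.
  by subst A; exists F; split=> // e eF; rewrite eF.
rewrite inE => /andP[eF eA].
have contraction : cycle_admissible A (e |: F) s ->
    exists T, tree_of A (e |: F) s T.
  move=> adCe; apply: IHn => //.
  - apply: leq_trans nAF; apply: proper_card; apply/properP; split.
      by apply: setDS; exact: subsetUr.
    by exists e; [rewrite inE eF|rewrite !inE eqxx].
  - by rewrite subUset sub1set eA.
  (* A cycle inside [e |: F] meets no sign condition, so admissibility would put the opposite of its
     signature in the cone too. *)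
  - move=> C cycC; apply/negP => CeF.
    have [dC supp] := sig cycC; have [fC _ C0] := directed_cycleP dC.
    have out f : f \notin e |: F -> sigma C f = 0.
      move=> feF; apply/eqP; rewrite -[_ == 0]negbK -in_support supp.
      by apply: contra feF; exact: (subsetP CeF).
    case/eqP: C0; apply: (pointed_gen Ksig cycC); apply: adCe.
    + exact: additive_predN (@flow_additive G) fC.
    + move=> f fA; rewrite ffunE out ?oppr0 //; apply: contra fA.
      by rewrite !inE => /predU1P[->//|/(subsetP FA)].
    + by move=> f fA feF; rewrite ffunE out // oppr0 mul0r.
  - move=> c cc c0 cA; apply: adD => // f.
      by move=> fF; apply: c0; rewrite !inE fF orbT.
    have [->|fe] := eqVneq f e => fA fF.
      by rewrite c0 ?mul0r // !inE eqxx.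
    by apply: cA => //; rewrite !inE negb_or fe.
have deletion : cocycle_admissible (A :\ e) F s ->
    exists T, tree_of (A :\ e) F s T.
  have FAe : F \subset A :\ e by rewrite subsetD1 FA.
  move=> adDe; apply: IHn => //.
  - apply: leq_trans nAF; apply: proper_card; apply/properP; split.
      by apply: setSD; exact: subsetDl.
    by exists e; [rewrite inE eF|rewrite !inE eqxx andbF].
  - apply: contrapT => /disconnected_cut[U [U0 [u [v [uU vU]]]]].
    have cU0 : cut_vec U = 0.
      apply: Ksig'; apply: adDe.
      + exact: cutv_cut_vec.
      + by move=> f /(subsetP FAe); exact: U0.
      + by move=> f fA _; rewrite U0 // mul0r.
      + exact: additive_predN (@cutv_additive G) (cutv_cut_vec U).
      + by move=> f /(subsetP FAe) fA; rewrite ffunE U0 ?oppr0.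
      + by move=> f fA _; rewrite ffunE U0 // oppr0 mul0r.
    have grad0 f : f \in [set: E] -> grad (fun v => (v \in U)%:R) f = 0.
      by move=> _; rewrite -cut_vecE cU0 ffunE.
    by have := grad_const connG grad0 u v; rewrite uU (negPf vU).
  - move=> k fk kA kF; apply: adC => // f.
      by move=> fA; apply: kA; rewrite !inE (negPf fA) andbF.
    have [->|fe] := eqVneq f e => fA fF.
      by rewrite kA ?mul0r // !inE eqxx.
    by apply: kF; rewrite // !inE fe.
have [adCe|nadCe] := pselect (cycle_admissible A (e |: F) s); last first.
  have adDe := admissible_minor adC adD nadCe.
  have [T tT] := deletion adDe; exists T; apply: (tree_of_delete tT) => //.
  have [trT [FT TA] cT dT] := tT.
  have eT : e \notin T by apply/negP => /(subsetP TA); rewrite !inE eqxx.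
  (* Were the fundamental cycle of [e] against [s], the obstruction [k] to contraction would satisfy
     the sign conditions of [flow_cone] for [T]. *)
  apply: contrapT; have [_ _ fe _] := fcP trT eT => /(pm1_sgnb fe) ce.
  have [k [fk nK kA kF ke]] := not_cycle_admissibleU1 adC nadCe.
  apply: nK; apply: (flow_cone trT fk) => f fT.
  have [->|nfe] := eqVneq f e; first by rewrite ce mulrN oppr_ge0 ltW.
  have [fA|fA] := boolP (f \in A); last by rewrite kA // mul0r.
  rewrite cT // ?inE ?nfe //; apply: kF => //.
  by apply: contra fT; exact: (subsetP FT).
have [T2 tT2] := contraction adCe; have [tr2 [FT2 TA2] _ d2] := tT2.
have e2 : e \in T2 by apply: (subsetP FT2); rewrite !inE eqxx.
have [_ _ fd2 _] := fdP tr2 e2.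
have [adDe|nadDe] := pselect (cocycle_admissible (A :\ e) F s); last first.
  exists T2; apply: (tree_of_contract tT2) => //.
  apply: contrapT => /(pm1_sgnb fd2) de.
  have [c [cc nK cF cA ce]] := not_cocycle_admissibleD1 adD nadDe.
  apply: nK; apply: (cutv_cone tr2 cc) => f f2.
  have [->|nfe] := eqVneq f e; first by rewrite de mulrN oppr_ge0 ltW.
  have [fF|fF] := boolP (f \in F); first by rewrite cF // mul0r.
  rewrite d2 // ?inE ?negb_or ?nfe //; apply: cA => //.
  exact: (subsetP TA2).
have [T1 tT1] := deletion adDe; have [tr1 [_ TA1] _ _] := tT1.
have e1 : e \notin T1 by apply/negP => /(subsetP TA1); rewrite !inE eqxx.
have [_ _ fc1 _] := fcP tr1 e1.
have [ce|/(pm1_sgnb fc1) ce] := pselect (fc T1 e e = sgnb (s e)).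
  by exists T1; exact: tree_of_delete tT1 _ ce.
have [de|/(pm1_sgnb fd2) de] := pselect (fd T2 e e = sgnb (s e)).
  by exists T2; exact: tree_of_contract tT2 _ de.
(* Both trees disagree with [s] at [e], so both belong to [s] reversed at [e] and coincide; but only
   [T2] contains [e]. *)
pose s' f := if f == e then ~~ s e else s f.
have ss' f : f != e -> s' f = s f by rewrite /s' => /negPf->.
have s'e : sgnb (s' e) = - sgnb (s e) by rewrite /s' eqxx sgnbN.
rewrite -s'e in ce de.
have T12 := tree_of_inj (tree_of_delete tT1 ss' ce)
  (tree_of_contract tT2 ss' de).
by rewrite T12 e2 in e1.
Qed.

End Trees.

(** * Trees assigned to compatible orientations *)

Section Orientations.
Variable G : multigraph.
Local Notation V := (vertex G).
Local Notation E := (edge G).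
Local Notation vec := {ffun E -> int}.
Implicit Types (k w c : vec) (A F T : {set E}) (s : E -> bool).
Implicit Types (O : {ffun E -> bool}).
Variables sigma sigma' : {set E} -> vec.
Hypotheses (connG : connected_graph G)
  (sig : cycle_signature sigma) (sig' : cocycle_signature sigma')
  (Ksig : pointed (@is_cycle G) sigma) (Ksig' : pointed (@is_cocycle G) sigma').

Local Notation K := (cone (@is_cycle G) sigma).
Local Notation K' := (cone (@is_cocycle G) sigma').
Local Notation fc T e := (sigma (fund_cycle T e)).
Local Notation fd T e := (sigma' (fund_cocycle T e)).
Local Notation tree_of := (tree_of sigma sigma').

(* The only vertex of the cube in [hoc sigma sigma' T]. *)
Definition tree_ori T : {ffun E -> bool} :=
  [ffun e => (if e \in T then fd T e e else fc T e e) == 1].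

Definition ori_vec O : vec := [ffun e => (O e)%:R].

Lemma ori_vec_inj : injective ori_vec.
Proof.
move=> O O' /ffunP OO'; apply/ffunP => e; have := OO' e; rewrite !ffunE.
by case: (O e); case: (O' e).
Qed.

Lemma ori_vec_shift O O' c : ori_vec O + c = ori_vec O' ->
  forall e, c e = (O' e)%:R - (O e)%:R.
Proof.
by move=> /ffunP OO' e; have := OO' e; rewrite !ffunE => <-; rewrite addrC addKr.
Qed.

Lemma pm1_eq1 (x : int) : x = 1 \/ x = -1 -> sgnb (x == 1) = x.
Proof. by case=> ->. Qed.

Lemma sgnb_tree_ori T e : spanning_tree T ->
  sgnb (tree_ori T e) = if e \in T then fd T e e else fc T e e.
Proof.
move=> trT; rewrite ffunE; case: ifPn => eT; apply: pm1_eq1.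
  by have [] := fdP connG sig' trT eT.
by have [] := fcP sig trT eT.
Qed.

Lemma sgnb_inj : injective sgnb.
Proof. by case; case. Qed.

Lemma tree_of_full s T : tree_of [set: E] set0 s T <->
  spanning_tree T /\ s =1 tree_ori T.
Proof.
split=> [[trT _ cT dT]|[trT sT]].
  split=> // e; apply: sgnb_inj; rewrite sgnb_tree_ori //; case: ifPn => eT.
    by rewrite dT ?inE.
  by rewrite cT ?inE.
split=> // [|e _ eT|e eT _]; first by rewrite sub0set subsetT.
  by rewrite sT sgnb_tree_ori // (negPf eT).
by rewrite sT sgnb_tree_ori // eT.
Qed.

Lemma cycle_signature_opp w : directed_cycle w ->
  w = sigma (support_of w) \/ w = - sigma (support_of w).
Proof.
move=> dw; have [|dC supp] := sig (C := support_of w); first by exists w.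
by apply: directed_cycle_eq.
Qed.

Lemma cocycle_signature_opp w : directed_cocycle w ->
  w = sigma' (support_of w) \/ w = - sigma' (support_of w).
Proof.
move=> dw; have [|dC supp] := sig' (C := support_of w); first by case: dw.
by apply: directed_cocycle_eq.
Qed.

Lemma conformal_eq0 w c e : conformal w c -> c e = 0 -> w e = 0.
Proof.
move=> wc ce; apply/eqP; apply: contraT => we.
by have := wc e we; rewrite ce mulr0.
Qed.

Lemma conformal_sgnb w c e b : conformal w c -> 0 <= c e * sgnb b ->
  0 <= w e * sgnb b.
Proof.
move=> wc; have [->|we] := eqVneq (w e) 0; first by rewrite mul0r.
by have := wc e we; case: b; rewrite ?mulr1 ?mulrN1; nia.
Qed.

(** By conformal decomposition only directed cycles need testing, and each is its signature or the
    opposite. *)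
Lemma cycle_admissibleP A F s :
    (forall w, directed_cycle w -> (forall e, e \notin A -> w e = 0) ->
      (forall e, e \in A -> e \notin F -> 0 <= w e * sgnb (s e)) ->
      w <> - sigma (support_of w)) ->
  cycle_admissible sigma A F s.
Proof.
move=> H k fk kA kF; apply: (cone_conformal (@flow_additive G) (D := @directed_cycle G)) fk _.
- exact: directed_cycleP.
- exact: flow_conformal_cycle.
move=> w dw wk; have [wE|] := cycle_signature_opp dw.
  by rewrite wE; apply: cone_gen; exists w.
move/H => -[] // e; first by move/kA; exact: conformal_eq0.
by move=> eA /(kF e eA); exact: conformal_sgnb.
Qed.

Lemma cocycle_admissibleP A F s :
    (forall w, directed_cocycle w -> (forall e, e \in F -> w e = 0) ->
      (forall e, e \in A -> e \notin F -> 0 <= w e * sgnb (s e)) ->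
      w <> - sigma' (support_of w)) ->
  cocycle_admissible sigma' A F s.
Proof.
move=> H c cc cF cA; apply: (cone_conformal (@cutv_additive G) (D := @directed_cocycle G)) cc _.
- exact: directed_cocycleP.
- exact: cutv_conformal_cocycle.
move=> w dw wc; have [wE|] := cocycle_signature_opp dw.
  by rewrite wE; apply: cone_gen; case: dw.
move/H => -[] // e; first by move/cF; exact: conformal_eq0.
by move=> eA /(cA e eA); exact: conformal_sgnb.
Qed.

Lemma contained_in_sgnb w O : unit_valued w ->
  contained_in w O <-> forall e, 0 <= w e * sgnb (O e).
Proof.
move=> wu; split=> [wO e|wO e]; have := wO e.
  case: (wu e) => ->; rewrite ?mul0r // => -[H1 H2]; first by rewrite H1.
  by rewrite H2.
by move=> we; split=> wE; move: we; rewrite wE; case: (O e).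
Qed.

(** Off [T] a contained cycle has the signs of the fundamental cycles, so it lies in the cone and
    cannot be opposite to its signature. *)
Lemma tree_ori_compatible T : spanning_tree T -> compatible sigma (tree_ori T).
Proof.
move=> trT w dw; have [fw wu w0] := directed_cycleP dw.
move/(contained_in_sgnb _ wu) => wT.
have cyc : is_cycle (support_of w) by exists w.
exists (support_of w) => //; have [//|wE] := cycle_signature_opp dw.
case/eqP: w0; apply: Ksig; last by rewrite wE opprK; exact: cone_gen.
apply: (flow_cone sig trT fw) => e eT.
by have := wT e; rewrite sgnb_tree_ori // (negPf eT).
Qed.

(** A directed cycle of [O'] has nonnegative products with [c], summing to zero; so it avoids the
    support of [c] and is contained in [O]. *)
Lemma compatible_shift O O' c : cutv c -> ori_vec O + c = ori_vec O' ->
  compatible sigma O -> compatible sigma O'.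
Proof.
move=> cc OO' compO w dw; have [fw wu w0] := directed_cycleP dw.
move/(contained_in_sgnb _ wu) => wO'; apply: compO => //.
apply/(contained_in_sgnb _ wu).
have cE := ori_vec_shift OO'.
have pos e : 0 <= w e * c e.
  have := wO' e; rewrite cE; case: (wu e) => ->; rewrite ?mul0r //;
    by case: (O' e); case: (O e).
have /eqP := flow_orth fw cc; rewrite psumr_eq0 // => /allP wc e.
have := wc e (mem_index_enum _); have := wO' e; rewrite /= cE.
by case: (wu e) => ->; rewrite ?mul0r //; case: (O' e); case: (O e).
Qed.

Definition assigned_to O T c : Prop :=
  [/\ spanning_tree T, cutv c & ori_vec O + c = ori_vec (tree_ori T)].

Lemma assigned_compatible O T c : assigned_to O T c -> compatible sigma O.
Proof.
move=> [trT cc OcT].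
apply: (compatible_shift (c := - c)) (tree_ori_compatible trT).
  exact: additive_predN (@cutv_additive G) cc.
by rewrite -OcT addrK.
Qed.

Lemma assigned_fd O T c e : assigned_to O T c -> e \in T -> c e != 0 ->
  c e = fd T e e.
Proof.
move=> [trT _ /ori_vec_shift/(_ e)] -> eT.
have := sgnb_tree_ori e trT; rewrite eT => <-.
by case: (tree_ori T e); case: (O e).
Qed.

Lemma assigned_unit O T c : assigned_to O T c -> unit_valued c.
Proof.
move=> [_ _ /ori_vec_shift cE] e; rewrite cE.
by case: (O e); case: (tree_ori T e);
  [constructor 1|constructor 3|constructor 2|constructor 1].
Qed.

(* On [T], a translate of a cube vertex into the position of [tree_ori T] moves
   each edge, if at all, in the direction of its fundamental cocycle. *)
Lemma assigned_cone O O' T c : spanning_tree T -> cutv c ->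
  ori_vec O + c = ori_vec O' -> O' = tree_ori T -> K' c.
Proof.
move=> trT cc /ori_vec_shift cE O'T; apply: (cutv_cone connG sig' trT cc) => e eT.
have := sgnb_tree_ori e trT; rewrite eT cE O'T => <-.
by case: (tree_ori T e); case: (O e).
Qed.

Lemma assigned_cone_sub O T1 T2 c1 c2 :
  assigned_to O T1 c1 -> assigned_to O T2 c2 -> K' (c1 - c2).
Proof.
move=> [tr1 cc1 E1] [tr2 cc2 E2].
apply: (assigned_cone tr1 (O := tree_ori T2) (O' := tree_ori T1)) => //.
  exact: (@cutv_additive G).2.
by rewrite -E1 -E2 -addrA subrKC.
Qed.

(** Both differences of the shifts lie in the cone, so the shifts agree; then the trees have the
    same orientation and [tree_of_inj] applies. *)
Lemma assigned_to_uniq O T1 T2 c1 c2 :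
  assigned_to O T1 c1 -> assigned_to O T2 c2 -> T1 = T2 /\ c1 = c2.
Proof.
move=> a1 a2; have c12 : c1 = c2.
  apply/subr0_eq/Ksig'; first exact: assigned_cone_sub a1 a2.
  by rewrite opprB; exact: assigned_cone_sub a2 a1.
split=> //; have [tr1 _ E1] := a1; have [tr2 _ E2] := a2.
have ori12 : tree_ori T1 = tree_ori T2.
  by apply: ori_vec_inj; rewrite -E1 -E2 c12.
apply: (tree_of_inj connG sig sig' Ksig Ksig' (A := [set: E]) (F := set0)
  (s := tree_ori T1)).
  by apply/tree_of_full.
by apply/tree_of_full; rewrite ori12.
Qed.

Lemma spanning_forest0 : @spanning_forest G set0.
Proof.
move=> C [w dw <-]; have [_ _ w0] := directed_cycleP dw.
apply: contra w0; rewrite subset0 => /eqP w0; apply/eqP/ffunP => e.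
by rewrite [RHS]ffunE; apply/eqP; rewrite -[_ == _]negbK -in_support w0 inE.
Qed.

(* The cocycle reversals of [O] are ordered by the cone of [sigma']; a maximal
   one is compatible with both signatures. *)
Lemma assigned_to_exists O : compatible sigma O ->
  exists T c, assigned_to O T c.
Proof.
move=> compO.
have [O' cO' maxO'] := exists_maximal ori_vec
  (Q := fun O' => cutv (ori_vec O' - ori_vec O)) (i0 := O) Ksig'
  (eq_ind_r (@cutv G) (@cutv_additive G).1 (subrr _)).
have compO' : compatible sigma O'.
  by apply: compatible_shift compO; [exact: cO'|rewrite subrKC].
have [|||||T /tree_of_full[trT O'T]] := tree_of_exists connG sig sig' Ksig Ksig'
  (A := [set: E]) (F := set0) (s := O').
- exact: sub0set.
- exact: spanning_forest0.
- exact: connG.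
- apply: cycle_admissibleP => w dw _ wO' wE.
  have [_ wu w0] := directed_cycleP dw.
  have [|C cyc wC] := compO' w dw.
    by apply/(contained_in_sgnb _ wu) => e; apply: wO'; rewrite inE.
  have [_ supp] := sig cyc; have suppw : support_of w = C by rewrite wC supp.
  rewrite suppw -wC in wE; case/eqP: w0; apply/ffunP => e.
  have /ffunP/(_ e)/eqP := wE; rewrite !ffunE.
  by rewrite -addr_eq0 -mulr2n mulrn_eq0 => /eqP.
- apply: cocycle_admissibleP => w dw _ wO' wE.
  have [cw wu w0] := directed_cocycleP connG dw.
  (* Reversing in [O'] a cocycle opposed to [sigma'] moves strictly up in the cone order. *)
  pose O2 := [ffun e => if w e == 0 then O' e else ~~ O' e].
  have O2E : ori_vec O2 = ori_vec O' - w.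
    apply/ffunP => e; rewrite !ffunE; have := wO' e; rewrite !inE => /(_ isT isT).
    by case: (wu e) => ->; rewrite ?mul0r ?subr0 //; case: (O' e).
  case/eqP: w0; apply/eqP; rewrite -oppr_eq0; apply/eqP.
  apply: (addrI (ori_vec O')); rewrite addr0 -O2E; apply: maxO'.
    by rewrite O2E addrAC; exact: (@cutv_additive G).2.
  by rewrite O2E addrC addKr wE opprK; apply: cone_gen; case: dw.
exists T, (ori_vec O' - ori_vec O); split=> //; rewrite subrKC.
by congr ori_vec; apply/ffunP.
Qed.

(** The generating set of the cell, by [half_open_cell_assigned]. *)
Definition fixed_part T c : {set E} := [set e in T | c e == 0].

Lemma fixed_part_forest O T c : assigned_to O T c ->
  spanning_forest (fixed_part T c).
Proof.
move=> [[forT _] _ _] C /forT; apply: contra => /subset_trans; apply.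
by apply/subsetP => e; rewrite inE => /andP[].
Qed.

(** On [T1], a zero of [c1] is also one of [c2]; elsewhere [c1 e] is the sign of the fundamental
    cocycle, and subtracting [c2 e], which is at most 1 in absolute value, cannot reverse it. *)
Lemma fixed_part_cone_sub O1 O2 T1 T2 c1 c2 :
    assigned_to O1 T1 c1 -> assigned_to O2 T2 c2 ->
    fixed_part T1 c1 = fixed_part T2 c2 ->
  K' (c1 - c2).
Proof.
move=> a1 a2 F12; have [tr1 cc1 _] := a1; have [tr2 cc2 _] := a2.
apply: (cutv_cone connG sig' tr1) => [|e eT]; first exact: (@cutv_additive G).2.
rewrite 2!ffunE; have [c1e|c1e] := eqVneq (c1 e) 0.
  have : e \in fixed_part T1 c1 by rewrite inE eT c1e eqxx.
  by rewrite F12 inE => /andP[_ /eqP->]; rewrite c1e subrr mul0r.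
rewrite -(assigned_fd a1 eT c1e).
have := assigned_unit a1 e; have := assigned_unit a2 e.
by case=> ->; case=> ->.
Qed.

Lemma assigned_tree_of O T c : assigned_to O T c ->
  tree_of (fixed_part T c :|: support_of c) (fixed_part T c)
    (fun e => c e == 1) T.
Proof.
move=> a; have [trT _ /ori_vec_shift cE] := a; split=> //.
- split; apply/subsetP => e; first by rewrite inE => /andP[].
  by move=> eT; rewrite !inE eT /=; case: (c e == 0).
- move=> e; rewrite !inE => ec eT; have := sgnb_tree_ori e trT.
  rewrite (negPf eT) => <-; congr sgnb; move: ec; rewrite (negPf eT) /= cE.
  by case: (tree_ori T e); case: (O e).
- move=> e eT; rewrite inE eT /= => ce; rewrite -(assigned_fd a eT ce).
  by case: (assigned_unit a e) ce => ->.
Qed.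

Lemma fixed_part_inj O1 O2 T1 T2 c1 c2 :
    assigned_to O1 T1 c1 -> assigned_to O2 T2 c2 ->
    fixed_part T1 c1 = fixed_part T2 c2 ->
  O1 = O2.
Proof.
move=> a1 a2 F12; have c12 : c1 = c2.
  apply/subr0_eq/Ksig'; first exact: fixed_part_cone_sub a1 a2 F12.
  by rewrite opprB; exact: fixed_part_cone_sub a2 a1 (esym F12).
subst c2; have t2 := assigned_tree_of a2; rewrite -F12 in t2.
have T12 := tree_of_inj connG sig sig' Ksig Ksig' (assigned_tree_of a1) t2.
have [_ _ E1] := a1; have [_ _ E2] := a2.
by apply: ori_vec_inj; apply: (addIr c1); rewrite E1 E2 T12.
Qed.

(** Encodes unit-valued vectors in a finite type, for [exists_maximal]. *)
Lemma unit_valued_diff w : unit_valued w ->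
  exists p : {ffun E -> bool * bool}, w = [ffun e => (p e).1%:R - (p e).2%:R].
Proof.
move=> wu; exists [ffun e => (w e == 1, w e == -1)]; apply/ffunP => e.
by rewrite !ffunE /=; case: (wu e) => ->.
Qed.

(* The optimality criterion that characterizes [c] in [assigned_to O T c] by
   [F = fixed_part T c] alone. *)
Definition maximal_cutv F c : Prop :=
  [/\ cutv c, unit_valued c, forall e, e \in F -> c e = 0
    & forall d, cutv d -> (forall e, e \in F -> d e = 0) ->
        unit_valued (c + d) -> K' d -> d = 0].

Lemma maximal_cutv_exists F : exists c, maximal_cutv F c.
Proof.
pose f (p : {ffun E -> bool * bool}) : vec := [ffun e => (p e).1%:R - (p e).2%:R].
have fu p : unit_valued (f p).
  by move=> e; rewrite ffunE; case: (p e) => [[] []] /=;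
    [constructor 1|constructor 2|constructor 3|constructor 1].
have f0 : f [ffun=> (false, false)] = 0.
  by apply/ffunP => e; rewrite !ffunE.
have [|p [cp pF] maxp] := exists_maximal f
  (Q := fun p => cutv (f p) /\ forall e, e \in F -> f p e = 0)
  (i0 := [ffun=> (false, false)]) Ksig'.
  by rewrite f0; split=> [|e _]; [exact: (@cutv_additive G).1|rewrite ffunE].
exists (f p); split=> // d cd dF /unit_valued_diff[q pdq] Kd.
have fq : f q = f p + d by rewrite pdq.
apply: (addrI (f p)); rewrite addr0 -fq; apply: maxp.
  split=> [|e eF]; first by rewrite fq; exact: additive_predD (@cutv_additive G) _ _.
  by rewrite fq ffunE pF // dF.
by rewrite fq addrC addKr.
Qed.

Lemma maximal_cutv_assigned F c : spanning_forest F -> maximal_cutv F c ->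
  exists O T, assigned_to O T c /\ fixed_part T c = F.
Proof.
move=> forF [cc cu cF cmax].
pose A := F :|: support_of c; pose s e := c e == 1.
have inA e : (e \in A) = (e \in F) || (c e != 0) by rewrite !inE.
have cs e : c e != 0 -> c e = sgnb (s e).
  by rewrite /s; case: (cu e) => ->.
have [|||||T [trT [FT TA] cT dT]] := tree_of_exists connG sig sig' Ksig Ksig'
  (A := A) (F := F) (s := s).
- exact: subsetUl.
- exact: forF.
(* If [A] did not connect, some cocycle would avoid [A]; with the sign that lies in the cone it
   could be added to [c]. *)
- apply: contrapT => /disconnected_cut[U [U0 [u [v [uU vU]]]]].
  have cU0 : cut_vec U != 0.
    apply/eqP => cU0.
    have grad0 f : f \in [set: E] -> grad (fun v => (v \in U)%:R) f = 0.
      by move=> _; rewrite -cut_vecE cU0 ffunE.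
    by have := grad_const connG grad0 u v; rewrite uU (negPf vU).
  have [w dw wU] := cutv_conformal_cocycle connG (cutv_cut_vec U) cU0.
  have [cw wu w0] := directed_cocycleP connG dw.
  have wA e : e \in A -> w e = 0 by move/U0; exact: conformal_eq0.
  have [d0 [cd du d_w]] : exists d0, [/\ d0 != 0, K' d0 & d0 = w \/ d0 = - w].
    have Kw : K' (sigma' (support_of w)) by apply: cone_gen; case: dw.
    have [wE|wE] := cocycle_signature_opp dw; [exists w|exists (- w)].
      by split; auto; rewrite wE.
    by split; auto; rewrite ?oppr_eq0 // wE opprK.
  have dA e : e \in A -> d0 e = 0.
    by move=> /wA we; case: d_w => ->; rewrite ?ffunE we ?oppr0.
  case/eqP: cd; apply: cmax => //.
  + by case: d_w => ->; [|exact: additive_predN (@cutv_additive G) cw].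
  + by move=> e eF; apply: dA; rewrite inA eF.
  + move=> e; rewrite ffunE; have [ce|ce] := eqVneq (c e) 0; last first.
      by rewrite dA ?addr0 ?inA ?ce ?orbT.
    rewrite ce add0r; case: d_w => -> //; rewrite ffunE.
    by case: (wu e) => ->; [constructor 1|constructor 3|constructor 2; rewrite opprK].
(* Such a cycle has nonnegative products with [c], so by orthogonality it avoids the support of [c]
   and lies in the forest [F]. *)
- apply: cycle_admissibleP => w dw wA ws _.
  have [fw wu w0] := directed_cycleP dw.
  have pos e : 0 <= w e * c e.
    have [->|ce] := eqVneq (c e) 0; first by rewrite mulr0.
    by rewrite cs // ws ?inA ?ce ?orbT //; apply: contra ce => /cF->.
  case/eqP: w0; apply: (forest_flow_eq0 forF fw) => e eF.
  have [eA|] := boolP (e \in A); last exact: wA.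
  have ce : c e != 0 by move: eA; rewrite inA (negPf eF).
  have /eqP := flow_orth fw cc; rewrite psumr_eq0 // => /allP/(_ e (mem_index_enum _)).
  by rewrite /= mulf_eq0 (negPf ce) orbF => /eqP.
(* Such a cocycle could be subtracted from [c]: where [c] is nonzero, [w] is zero or equal to [c],
   so entries stay in {-1, 0, 1}. *)
- apply: cocycle_admissibleP => w dw wF ws wE.
  have [cw wu w0] := directed_cocycleP connG dw.
  case/eqP: w0; apply/eqP; rewrite -oppr_eq0; apply/eqP; apply: cmax.
  + exact: additive_predN (@cutv_additive G) cw.
  + by move=> e /wF we; rewrite ffunE we oppr0.
  + move=> e; rewrite !ffunE; have [ce|ce] := eqVneq (c e) 0.
      rewrite ce add0r.
      by case: (wu e) => ->; [constructor 1|constructor 3|constructor 2; rewrite opprK].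
    have : 0 <= w e * c e.
      by rewrite cs // ws ?inA ?ce ?orbT //; apply: contra ce => /cF->.
    move: ce; case: (cu e) => ->; case: (wu e) => -> // _ _;
      by [constructor 1|constructor 2|constructor 3].
  + by rewrite wE opprK; apply: cone_gen; case: dw.
have oriE e : c e != 0 -> tree_ori T e = s e.
  move=> ce; apply: sgnb_inj; rewrite sgnb_tree_ori //; case: ifPn => eT.
    by apply: dT => //; apply: contra ce => /cF->.
  by apply: cT => //; rewrite inA ce orbT.
exists [ffun e => if c e == 0 then tree_ori T e else ~~ tree_ori T e], T.
split; first split=> //.
  apply/ffunP => e; rewrite 2!ffunE [in RHS]ffunE [in X in (nat_of_bool X)%:R]ffunE.
  have [->|ce] := eqVneq (c e) 0; first by rewrite addr0.
  by rewrite oriE // cs //; case: (s e).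
apply/setP => e; rewrite inE; apply/andP/idP => [[eT /eqP ce]|eF].
  by have := subsetP TA e eT; rewrite inA ce eqxx orbF.
by rewrite (subsetP FT) // cF.
Qed.

End Orientations.

(** * Half-open cells *)

Section RealPart.
Variables (R : realType) (G : multigraph).
Local Notation V := (vertex G).
Local Notation E := (edge G).
Local Notation vec := {ffun E -> int}.
Implicit Types (c w : vec) (T J : {set E}) (O : {ffun E -> bool}).
Implicit Types (x : {ffun E -> R}).

(** Adding the expansions of [k] and [- k] gives a vanishing combination with coefficients
    [a C + b C]. *)
Lemma acyclic_pointed (P : {set E} -> Prop) (sigma : {set E} -> vec) :
  acyclic_on R P sigma -> pointed P sigma.
Proof.
move=> acy k [a kE] [b NkE].
suff ab0 C : P C -> a C = 0%N.
  by rewrite kE big1 // => C /asboolP/ab0->; rewrite mulr0n.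
move=> PC; suff : (a C + b C)%:R = 0 :> R.
  by move/eqP; rewrite pnatr_eq0 addn_eq0 => /andP[/eqP].
apply: (acy (fun C => (a C + b C)%:R)) PC => [C' _|e]; first exact: ler0n.
have : \sum_(C : {set E} | `[< P C >]) sigma C *+ (a C + b C) = 0.
  by under eq_bigr do rewrite mulrnDr; rewrite big_split /= -kE -NkE subrr.
move/ffunP/(_ e); rewrite sum_ffunE ffunE => /(congr1 (fun z : int => z%:~R : R)).
rewrite /= mulr0z => s0; rewrite -[RHS]s0 rmorph_sum /=; apply: eq_bigr => C' _.
by rewrite ffunMnE rmorphMn /= mulr_natl.
Qed.

Lemma im_ZP c : (0 < #|V|)%N -> im_Z R c <-> cutv c.
Proof.
move=> V0; pose vx (i : 'I_#|V|.-1) : V := enum_val (widen_ord (leq_pred #|V|) i).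
pose pot (y : 'cV[R]_(#|V|.-1)) v : R := \sum_i (v == vx i)%:R * y i 0.
have mulE (y : 'cV[R]_(#|V|.-1)) e :
    ((incidence G R)^T *m y) (enum_rank e) 0 = pot y (ehead e) - pot y (etail e).
  rewrite mxE -sumrB; apply: eq_bigr => i _.
  by rewrite !mxE enum_rankK mulrBl.
split=> [[y cy]|[h cE]].
  (* [pot y] extends [y] by 0 at the last vertex; its differences along edges are integers, so
     floors preserve them. *)
  exists (fun v => Num.floor (pot y v)); apply/ffunP => e; rewrite ffunE.
  have /matrixP/(_ (enum_rank e) 0) := cy; rewrite mulE mxE enum_rankK => ce.
  have -> : pot y (ehead e) = (c e)%:~R + pot y (etail e) by rewrite ce subrK.
  by rewrite floorDzr ?intr_int // intrKfloor addrK.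
have lastP : (#|V|.-1 < #|V|)%N by rewrite prednK.
pose v0 : V := enum_val (Ordinal lastP).
(* Normalised to vanish at the vertex of the removed row; the gradient is unchanged. *)
exists (\col_i (h (vx i) - h v0)%:~R); apply/matrixP => j z.
rewrite ord1 -(enum_valK j) mulE !mxE cE ffunE enum_rankK.
suff potE v : pot (\col_i (h (vx i) - h v0)%:~R) v = (h v - h v0)%:~R.
  by rewrite !potE -rmorphB; congr (_%:~R); lia.
transitivity (\sum_i (v == vx i)%:R * (h v - h v0)%:~R : R).
  by apply: eq_bigr => i _; rewrite mxE; case: eqP => [->|]; rewrite ?mul0r.
have [->|vv0] := eqVneq v v0.
  by rewrite subrr big1 // => i _; rewrite mulr0.
have lt_v : (enum_rank v < #|V|.-1)%N.
  have := ltn_ord (enum_rank v); rewrite -[X in (_ < X)%N -> _](prednK V0) ltnS leq_eqVlt.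
  case/predU1P => // vl; case/eqP: vv0; rewrite -[v]enum_rankK /v0.
  by congr enum_val; apply: val_inj.
have vE : v = vx (Ordinal lt_v).
  by rewrite -[LHS]enum_rankK; congr enum_val; apply: val_inj.
rewrite (bigD1 (Ordinal lt_v)) //= -vE eqxx mul1r big1 ?addr0 // => i iv.
case: eqP => [vi|]; last by rewrite mul0r.
case/eqP: iv; apply: val_inj => /=.
by rewrite vi enum_valK.
Qed.

(** With the other coordinates kept as in [x0], coordinate [e] takes two values in the cell if [e]
    is in [J], but only one if [e] is not in [J']. *)
Lemma half_open_cell_generating_subset J J' (A : set {ffun E -> R}) x0 :
  A x0 -> half_open_cell J A -> half_open_cell J' A -> J \subset J'.
Proof.
move=> Ax0 [I [IJ _ AE]] [I' [_ IJ' AE']]; apply/subsetP => e eJ.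
apply: contraT => eJ'.
have x0I f : x0 f \in I f by move: Ax0; rewrite AE.
have pt y : y \in I e -> y = x0 e.
  move=> yI; have Ay : A [ffun f => if f == e then y else x0 f].
    by rewrite AE => f; rewrite ffunE; case: eqP => [->|].
  move: Ay Ax0; rewrite AE' => /(_ e) Ay /(_ e); move: Ay; rewrite ffunE eqxx.
  have [a ->] := IJ' e eJ'; rewrite !in_itv /= => /andP[? ?] /andP[? ?].
  lra.
have [a [Ie|Ie]] := IJ e eJ.
  have e1 : a%:~R = x0 e by apply: pt; rewrite Ie in_itv /=; lra.
  have e2 : a%:~R - 2^-1 = x0 e by apply: pt; rewrite Ie in_itv /=; lra.
  by clear -e1 e2; exfalso; lra.
have e1 : a%:~R = x0 e by apply: pt; rewrite Ie in_itv /=; lra.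
have e2 : a%:~R + 2^-1 = x0 e by apply: pt; rewrite Ie in_itv /=; lra.
by clear -e1 e2; exfalso; lra.
Qed.

Lemma half_open_cell_generating_uniq J J' (A : set {ffun E -> R}) x0 :
  A x0 -> half_open_cell J A -> half_open_cell J' A -> J = J'.
Proof.
move=> Ax0 cJ cJ'; apply/eqP; rewrite eqEsubset.
by rewrite (half_open_cell_generating_subset Ax0 cJ cJ')
  (half_open_cell_generating_subset Ax0 cJ' cJ).
Qed.

Variables sigma sigma' : {set E} -> vec.
Hypotheses (connG : connected_graph G) (hV : (1 < #|V|)%N)
  (hsigma : acyclic_cycle_signature R sigma)
  (hsigma' : acyclic_cocycle_signature R sigma').

Local Notation tree_ori := (tree_ori sigma sigma').
Local Notation assigned_to := (assigned_to sigma sigma').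

Let sig : cycle_signature sigma := hsigma.1.
Let sig' : cocycle_signature sigma' := hsigma'.1.
Let Ksig : pointed (@is_cycle G) sigma := acyclic_pointed hsigma.2.
Let Ksig' : pointed (@is_cocycle G) sigma' := acyclic_pointed hsigma'.2.

Lemma oriented_asE x w e b : w e = sgnb b -> oriented_as x w e <-> x e = b%:R.
Proof.
rewrite /oriented_as => ->; case: b; split; try by auto.
- by case=> -[].
- by case=> -[].
Qed.

Lemma shifted_cellE T c x : spanning_tree T ->
  shifted_cell R sigma sigma' T c x <->
  forall e, 0 <= x e <= 1 /\
    (x e + (c e)%:~R = (tree_ori T e)%:R
     \/ e \in T /\ 0 < x e + (c e)%:~R < 1).
Proof.
move=> trT; have oriE (y : {ffun E -> R}) e : oriented_as y
    (if e \in T then sigma' (fund_cocycle T e) else sigma (fund_cycle T e)) e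
    <-> y e = (tree_ori T e)%:R.
  by apply: oriented_asE; rewrite (sgnb_tree_ori connG sig sig') //; case: ifP.
split=> [[[y [_ yout yin] <-] cx] e|xP].
  split; first exact: cx.
  have -> : (y - of_int R c) e + (c e)%:~R = y e by rewrite !ffunE subrK.
  have := oriE y e; case: ifPn => eT oE.
    by have [/oE|?] := yin e eT; [left|right].
  by left; apply/oE/yout.
split; last by move=> e; have [] := xP e.
exists (x + of_int R c); last by rewrite addrK.
have yE e : (x + of_int R c) e = x e + (c e)%:~R by rewrite !ffunE.
split=> [e|e eT|e eT].
- rewrite yE; have [_ [->|[_ /andP[/ltW-> /ltW->]]//]] := xP e.
  by case: (tree_ori T e); rewrite /= ?lexx ler01.
- have := oriE (x + of_int R c) e; rewrite (negPf eT) yE => ->.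
  by have [_ [//|[]]] := xP e; rewrite (negPf eT).
- have := oriE (x + of_int R c) e; rewrite eT /bioriented yE => oE.
  by have [_ [/oE|[_ ?]]] := xP e; [left|right].
Qed.

Lemma int_not_between (z : int) : ~~ (0 < (z%:~R : R) < 1).
Proof. by rewrite ltr0z ltrz1; lia. Qed.

(** No edge is bi-oriented at an integral point, so the only integral point of [hoc] is
    [tree_ori T]. *)
Lemma assignedE O T c :
  assigned R sigma sigma' O (T, c) <-> assigned_to O T c.
Proof.
have V0 : (0 < #|V|)%N by exact: ltnW.
have sumE e : of_bool R O e + (c e)%:~R = ((O e)%:R + c e)%:~R :> R.
  by rewrite ffunE rmorphD /= natz.
split=> [[/= trT /(im_ZP c V0) cc /(shifted_cellE c _ trT) OP]|[trT cc OcT]].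
  split=> //; apply/ffunP => e.
  rewrite ffunE [ori_vec O e]ffunE [ori_vec (tree_ori T) e]ffunE.
  have [_ [|[_]]] := OP e; rewrite sumE; last by rewrite (negPf (int_not_between _)).
  by move=> sumO; apply: (@intr_inj R); rewrite sumO rmorph_nat.
split=> //=; first exact/im_ZP.
apply/shifted_cellE => // e; split.
  by rewrite ffunE; case: (O e); rewrite /= ?lexx ler01.
left; rewrite sumE; have /ffunP/(_ e) := OcT.
rewrite ffunE [ori_vec O e]ffunE [ori_vec (tree_ori T) e]ffunE => ->.
by rewrite rmorph_nat.
Qed.

(** An edge of [T] with [c e = 0] keeps its interval, closed at the end given by [tree_ori T]; if
    [c e] is nonzero, the shifted interval meets the unit interval only in [O e]. *)
Lemma half_open_cell_assigned O T c : assigned_to O T c ->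
  half_open_cell (fixed_part T c) (shifted_cell R sigma sigma' T c).
Proof.
move=> a; have [trT _ /ori_vec_shift cE] := a.
exists (fun e => if e \in fixed_part T c
  then if tree_ori T e then `]1%:~R - 1, 1%:~R] else `[0%:~R, 0%:~R + 1[
  else `[((O e)%:R : int)%:~R, ((O e)%:R : int)%:~R]).
split=> [e ->|e /negPf->|].
- by case: (tree_ori T e); [exists 1; left|exists 0; right].
- by exists (O e)%:R.
suff memE x e : (0 <= x e <= 1 /\ (x e + (c e)%:~R = (tree_ori T e)%:R
      \/ e \in T /\ 0 < x e + (c e)%:~R < 1)) <->
    x e \in (if e \in fixed_part T c
      then if tree_ori T e then `]1%:~R - 1, 1%:~R] else `[0%:~R, 0%:~R + 1[
      else `[((O e)%:R : int)%:~R, ((O e)%:R : int)%:~R]).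
  apply/seteqP; split=> x /=; first by move/(shifted_cellE c x trT) => H e; exact/memE.
  by move=> H; apply/(shifted_cellE c x trT) => e; exact/memE.
have -> : (c e)%:~R = (tree_ori T e)%:R - (O e)%:R :> R.
  by rewrite cE rmorphB /= !rmorph_nat.
have -> : (e \in fixed_part T c) = (e \in T) && (O e == tree_ori T e).
  by rewrite inE cE; case: (O e); case: (tree_ori T e).
rewrite rmorph_nat; case: (e \in T); case: (O e); case: (tree_ori T e);
  rewrite /= in_itv /=; split; lra.
Qed.

End RealPart.

(** * From assigned pairs to [phi] and its bijectivity *)

Theorem theorem3p30 (R : realType) (G : multigraph)
    (sigma sigma' : {set edge G} -> {ffun edge G -> int})
    (hconn : connected_graph G)
    (hV : (1 < #|vertex G|)%N)
    (hsigma : acyclic_cycle_signature R sigma)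
    (hsigma' : acyclic_cocycle_signature R sigma') :
  [/\ forall O : {ffun edge G -> bool}, compatible sigma O ->
        exists! p : {set edge G} * {ffun edge G -> int},
          assigned R sigma sigma' O p,
      forall (O : {ffun edge G -> bool})
             (p : {set edge G} * {ffun edge G -> int}),
        compatible sigma O -> assigned R sigma sigma' O p ->
        half_open_cell (phi R sigma sigma' O)
                       (shifted_cell R sigma sigma' p.1 p.2)
    & set_bij [set O : {ffun edge G -> bool} | compatible sigma O]%classic
              [set F : {set edge G} | spanning_forest F]%classic
              (phi R sigma sigma')].
Proof.
have [sig /acyclic_pointed Ksig] := hsigma.
have [sig' /acyclic_pointed Ksig'] := hsigma'.
have asgP O T c := assignedE hconn hV hsigma hsigma' O T c.
(* The choice made by [xget] is forced: the pair is unique, and a nonempty cell determines its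
   generating set. *)
have phiE O T c : assigned_to sigma sigma' O T c ->
    phi R sigma sigma' O = fixed_part T c.
  move=> a; have cellTc := half_open_cell_assigned hconn hsigma hsigma' a.
  have [[T' c'] /asgP a' cell'] := xgetPex set0
    (P := [set J : {set edge G} | exists2 p, assigned R sigma sigma' O p
      & half_open_cell J (shifted_cell R sigma sigma' p.1 p.2)]%classic)
    (ex_intro _ _ (ex_intro2 _ _ (T, c) (proj2 (asgP O T c) a) cellTc)).
  have [TT' cc'] := assigned_to_uniq hconn sig sig' Ksig Ksig' a a'; subst T' c'.
  have [_ _ OA] := proj2 (asgP O T c) a.
  exact: half_open_cell_generating_uniq OA cell' cellTc.
have exO O : compatible sigma O -> exists T c, assigned_to sigma sigma' O T c.
  exact: assigned_to_exists.
split=> [O /exO[T [c a]]|O [T c] _ /asgP a|].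
- exists (T, c); split; first exact/asgP.
  move=> [T' c'] /asgP a'.
  by have [-> ->] := assigned_to_uniq hconn sig sig' Ksig Ksig' a a'.
- rewrite (phiE _ _ _ a) /=.
  by have := half_open_cell_assigned hconn hsigma hsigma' a.
split=> [O /exO[T [c a]]|O1 O2|F forF].
- by rewrite /= (phiE _ _ _ a); exact: fixed_part_forest a.
- move=> /set_mem/exO[T1 [c1 a1]] /set_mem/exO[T2 [c2 a2]].
  rewrite (phiE _ _ _ a1) (phiE _ _ _ a2).
  by move/(fixed_part_inj hconn sig sig' Ksig Ksig' a1 a2).
have [c maxc] := maximal_cutv_exists Ksig' F.
have [O [T [a FE]]] := maximal_cutv_assigned hconn sig sig' Ksig Ksig' forF maxc.
exists O; last by rewrite (phiE _ _ _ a).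
exact: assigned_compatible a.
Qed.
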